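(* Let $G$ be a non-abelian limit group, let $p$ be a prime number, and let $U$ be a normal subgroup of $G$ of index $p$. Then $\mathrm{rk}_{\mathbb{Q}}(U) > \mathrm{rk}_{\mathbb{Q}}(G)$.
   Context: A limit group (also called a fully residually free group, or $\omega$-residually free group) is a finitely generated group $G$ such that for every finite subset $T\subseteq G$ there exists a homomorphism from $G$ to a free group that is injective on $T$. For a finitely generated group $G$ with abelianization $G^{\mathrm{ab}}=G/[G,G]$, the rational rank is $\mathrm{rk}_{\mathbb{Q}}(G)=\dim_{\mathbb{Q}}(G^{\mathrm{ab}}\otimes_{\mathbb{Z}}\mathbb{Q})=\dim_{\mathbb{Q}}H_1(G,\mathbb{Q})$. *)

(* Defs.v *)
From HB Require Import structures.
From mathcomp Require Import all_boot all_algebra.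
(* Last, so that [~ x, y], x ^ y, commute, etc. are those of groupType and not
   those of finGroupType. *)
From mathcomp Require Import monoid.
From mathcomp Require Import boolp classical_sets cardinality.
From mathcomp.multinomials Require Import freeg.

Set Implicit Arguments.
Unset Strict Implicit.
Unset Printing Implicit Defensive.

Import GRing.Theory.

Local Open Scope quotient_scope.
Local Open Scope group_scope.

Notation groupHom G H := (UMagmaMorphism.type G H).

(* By the excluded middle (`[< _ >]), a boolean {pred G} is an arbitrary subset
   of G. *)
Section Subgroups.
Variable G : groupType.
Implicit Types (S U : {pred G}).

Definition gen S : {pred G} := fun g =>
  `[< forall H : {pred G}, group_closed H -> {subset S <= H} -> g \in H >].

Definition finitely_generated : Prop :=
  exists s : seq G, forall g : G, g \in gen [in s].

Definition derived : {pred G} :=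
  gen (fun g => `[< exists x y : G, g = [~ x, y] >]).

Definition normal_subgroup (U : groupClosed G) : Prop :=
  forall u g : G, u \in U -> u ^ g \in U.

Definition lcoset U (g : G) : set G := [set h | g^-1 * h \in U]%classic.

Definition has_index U (n : nat) : Prop :=
  (range (lcoset U) #= `I_n)%card.

Definition abelian_group : Prop := forall x y : G, commute x y.

Lemma gen_group_closed S : group_closed (gen S).
Proof.
split=> [|x y /asboolP xS /asboolP yS]; apply/asboolP => H gH SH.
  by case: gH.
by apply: gH.2; [exact: xS | exact: yS].
Qed.

Lemma mem_gen S : {subset S <= gen S}.
Proof. by move=> x xS; apply/asboolP => H _; exact. Qed.

Lemma commg_derived (x y : G) : [~ x, y] \in derived.
Proof. by apply: mem_gen; apply/asboolP; exists x, y. Qed.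

Lemma derived_group_closed : group_closed derived.
Proof. exact: gen_group_closed. Qed.

Fact derived1 : 1 \in derived. Proof. by case: derived_group_closed. Qed.

HB.instance Definition _ :=
  isMulClosed.Build G derived (group_closedM derived_group_closed).
HB.instance Definition _ := isMul1Closed.Build G derived derived1.
HB.instance Definition _ :=
  isInvClosed.Build G derived (group_closedV derived_group_closed).

Lemma derivedJ (u g : G) : u \in derived -> u ^ g \in derived.
Proof.
move=> du; have -> : u ^ g = u * [~ u, g] by rewrite commgEl mulgA mulgV mul1g.
by rewrite gpredM // commg_derived.
Qed.

End Subgroups.

Arguments derived : clear implicits.

(* The universal property of a basis e : X -> F; uniqueness is stated with =1
   because homomorphisms are bundled. *)
Definition is_free_group (F : groupType) : Prop :=
  exists (X : Type) (e : X -> F),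
    forall (H : groupType) (f : X -> H),
      exists2 h : groupHom F H, (forall x, h (e x) = f x) &
        forall h' : groupHom F H, (forall x, h' (e x) = f x) -> h' =1 h.

Definition limit_group (G : groupType) : Prop :=
  finitely_generated G /\
  forall T : seq G, exists2 F : groupType, is_free_group F &
    exists h : groupHom G F, {in T &, injective h}.

Section SubgroupType.
Variables (G : groupType) (U : groupClosed G).

Definition subgroup := {x : G | x \in U}.

Fact subgroup_closed : group_closed U.
Proof. by split=> [|x y xU yU]; [exact: gpred1 | exact: gpredF]. Qed.

HB.instance Definition _ := SubChoice.on subgroup.
HB.instance Definition _ :=
  SubChoice_isSubGroup.Build G (fun x => x \in U) subgroup subgroup_closed.

End SubgroupType.

Section Abelianization.
Variable G : groupType.
Implicit Types x y z : G.

Definition ab_equiv x y := x^-1 * y \in derived G.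

Fact ab_equiv_is_equiv : equiv_class_of ab_equiv.
Proof.
split=> [x|x y|y x z]; rewrite /ab_equiv.
- by rewrite mulVg gpred1.
- by rewrite -gpredV invgM invgK.
- by move=> xy yz; rewrite -[z](mulVKg y) mulgA gpredM.
Qed.

Canonical ab_equiv_equiv := EquivRelPack ab_equiv_is_equiv.
Canonical ab_equiv_encModRel := defaultEncModRel ab_equiv.

(* The quotient G / [G, G], with its additively written group law. *)
Definition abelianization := {eq_quot ab_equiv}.

HB.instance Definition _ : EqQuotient G ab_equiv abelianization :=
  EqQuotient.on abelianization.
HB.instance Definition _ := Choice.on abelianization.

Definition ab_zero : abelianization := lift_cst abelianization (1 : G).
Definition ab_add := lift_op2 abelianization (fun x y : G => x * y).
Definition ab_opp := lift_op1 abelianization (fun x : G => x^-1).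

Canonical pi_ab_zero_morph := PiConst ab_zero.

Lemma ab_eqP x y :
  reflect (x = y %[mod abelianization]) (x^-1 * y \in derived G).
Proof. by apply: (iffP idP) => [xy|/eqmodP//]; apply/eqmodP. Qed.

Fact pi_ab_opp : {morph \pi_abelianization : x / x^-1 >-> ab_opp x}.
Proof.
move=> x; unlock ab_opp; apply/ab_eqP; rewrite invgK.
have /ab_eqP : repr (\pi_abelianization x) = x %[mod abelianization].
  by rewrite reprK.
set y := repr _ => /(@derivedJ _ _ y^-1).
by rewrite conjgE invgK !mulgA mulgV mul1g.
Qed.
Canonical pi_ab_opp_morph := PiMorph1 pi_ab_opp.

Fact pi_ab_add : {morph \pi_abelianization : x y / x * y >-> ab_add x y}.
Proof.
move=> x y; unlock ab_add; apply/ab_eqP.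
have /ab_eqP dx : x = repr (\pi_abelianization x) %[mod abelianization].
  by rewrite reprK.
have /ab_eqP dy : y = repr (\pi_abelianization y) %[mod abelianization].
  by rewrite reprK.
move: dx dy; set x' := repr (\pi x); set y' := repr (\pi y) => dx dy.
have -> : (x * y)^-1 * (x' * y') = (x^-1 * x') ^ y * (y^-1 * y').
  by rewrite conjgE invgM !mulgA mulgK.
by rewrite gpredM // derivedJ.
Qed.
Canonical pi_ab_add_morph := PiMorph2 pi_ab_add.

Fact ab_addA : associative ab_add.
Proof. by move=> x y z; rewrite -[x]reprK -[y]reprK -[z]reprK !piE mulgA. Qed.

Fact ab_addC : commutative ab_add.
Proof.
move=> x y; rewrite -[x]reprK -[y]reprK !piE; apply/ab_eqP.
by rewrite invgM -mulgA; exact: (commg_derived (repr y) (repr x)).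
Qed.

Fact ab_add0 : left_id ab_zero ab_add.
Proof. by move=> x; rewrite -[x]reprK !piE mul1g. Qed.

Fact ab_addN : left_inverse ab_zero ab_opp ab_add.
Proof. by move=> x; rewrite -[x]reprK !piE mulVg. Qed.

HB.instance Definition _ :=
  GRing.isZmodule.Build abelianization ab_addA ab_addC ab_add0 ab_addN.

End Abelianization.

Local Open Scope ring_scope.

(* A (x)_Z B: the free abelian group on A * B modulo the subgroup generated by
   the bilinearity relations. *)
Section Tensor.
Variables A B : zmodType.

Local Notation free := {freeg (A * B)%type / int}.

Definition bilin_rel : {pred free} := fun x => `[<
  (exists a a' b, x = << (a + a', b) >> - << (a, b) >> - << (a', b) >>) \/
  (exists a b b', x = << (a, b + b') >> - << (a, b) >> - << (a, b') >>) >].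

Definition tensor_rel : {pred free} := fun x =>
  `[< forall S : {pred free}, zmod_closed S ->
        {subset bilin_rel <= S} -> x \in S >].

Fact tensor_rel_zmod_closed : zmod_closed tensor_rel.
Proof.
split=> [|x y /asboolP xS /asboolP yS]; apply/asboolP => S zS RS.
  by case: zS.
by apply: zS.2; [exact: xS | exact: yS].
Qed.

HB.instance Definition _ :=
  GRing.isZmodClosed.Build free tensor_rel tensor_rel_zmod_closed.

Definition tensor := ring_quotient.Quotient.quot tensor_rel.

HB.instance Definition _ := GRing.Zmodule.on tensor.

Definition tens_pi (x : free) : tensor := \pi_tensor x.

Fact tens_pi_is_zmod_morphism : zmod_morphism tens_pi.
Proof. by move=> x y; rewrite /tens_pi !piE. Qed.

HB.instance Definition _ :=
  GRing.isZmodMorphism.Build free tensor tens_pi tens_pi_is_zmod_morphism.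

Definition tens (a : A) (b : B) : tensor := tens_pi << (a, b) >>.

Lemma tens_eqP (x y : free) :
  reflect (tens_pi x = tens_pi y) (x - y \in tensor_rel).
Proof. by rewrite ring_quotient.Quotient.idealrBE; exact: eqP. Qed.

Lemma mem_tensor_rel : {subset bilin_rel <= tensor_rel}.
Proof. by move=> x Rx; apply/asboolP => S _; exact. Qed.

Lemma tensDl a a' b : tens (a + a') b = tens a b + tens a' b.
Proof.
rewrite /tens -raddfD; apply/tens_eqP; rewrite opprD addrA.
by apply: mem_tensor_rel; apply/asboolP; left; exists a, a', b.
Qed.

Lemma tensDr a b b' : tens a (b + b') = tens a b + tens a b'.
Proof.
rewrite /tens -raddfD; apply/tens_eqP; rewrite opprD addrA.
by apply: mem_tensor_rel; apply/asboolP; right; exists a, b, b'.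
Qed.

Lemma tensor_ind (P : tensor -> Prop) :
    P 0 -> (forall x y, P x -> P y -> P (x - y)) ->
    (forall a b, P (tens a b)) ->
  forall x, P x.
Proof.
move=> P0 PB Pt x.
have PN y : P y -> P (- y) by move=> Py; rewrite -sub0r; exact: PB.
have PD y z : P y -> P z -> P (y + z).
  by move=> Py Pz; rewrite -[z]opprK; apply: PB => //; exact: PN.
have PMn y n : P y -> P (y *+ n).
  by move=> Py; elim: n => [|n IHn]; rewrite ?mulr0n ?mulrS //; exact: PD.
rewrite -[x]reprK -/(tens_pi _) -[repr x]freeg_sumE raddf_sum /=.
elim: (dom _) => [|[a b] s IHs]; first by rewrite big_nil.
rewrite big_cons; apply: PD => //; rewrite -[coeff _ _]intz -freegU_mulz raddfMz.
have Pab : P (tens_pi << (a, b) >>) by exact: Pt.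
by case: (coeff _ _) => n; rewrite ?NegzE ?mulrNz -pmulrn; auto.
Qed.

Definition biadditive (V : zmodType) (f : A -> B -> V) : Prop :=
  (forall b, {morph f^~ b : a a' / a + a'}) /\
  (forall a, {morph f a : b b' / b + b'}).

Lemma tens_biadditive : biadditive tens.
Proof. by split=> [b a a'|a b b']; rewrite (tensDl, tensDr). Qed.

Definition tlift (V : zmodType) (f : A -> B -> V) (x : tensor) : V :=
  fglift (fun k => f k.1 k.2 : zmodule V) (repr x).

Lemma tlift_pi (V : zmodType) (f : A -> B -> V) (x : free) : biadditive f ->
  tlift f (tens_pi x) = fglift (fun k => f k.1 k.2 : zmodule V) x.
Proof.
move=> [fDl fDr]; set F := fglift _.
have FB : {morph F : y z / y - z} by exact: lift_is_additive.
have FU a b : F << (a, b) >> = f a b by rewrite /F liftU scale1r.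
apply/eqP; rewrite -subr_eq0 -FB.
have /tens_eqP : tens_pi (repr (tens_pi x)) = tens_pi x by rewrite /tens_pi reprK.
pose K : {pred free} := fun y => F y == 0.
move=> /asboolP /(_ K); apply.
  split=> [|y z]; rewrite !unfold_in /K; first by rewrite -(subrr 0) FB subrr.
  by move=> /eqP Fy /eqP Fz; rewrite FB Fy Fz subrr.
move=> y /asboolP [] [? [? [? ->]]]; rewrite unfold_in /K !FB !FU ?fDl ?fDr;
  by rewrite addrAC addrK subrr.
Qed.

Lemma tliftE (V : zmodType) (f : A -> B -> V) a b : biadditive f ->
  tlift f (tens a b) = f a b.
Proof. by move=> fbi; rewrite tlift_pi // liftU scale1r. Qed.

Lemma tlift_is_zmod_morphism (V : zmodType) (f : A -> B -> V) :
  biadditive f -> zmod_morphism (tlift f).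
Proof.
move=> fbi x y; rewrite -[x]reprK -[y]reprK -!/(tens_pi _) -raddfB !tlift_pi //.
exact: (@lift_is_additive _ _ (zmodule V)).
Qed.

End Tensor.

(* The module structure of A (x)_Z B induced by one of B:
   c (a (x) b) = a (x) (c b). *)
Section TensorModule.
Variables (R : nzRingType) (A : zmodType) (B : lmodType R).

Definition tscale (c : R) : tensor A B -> tensor A B :=
  tlift (fun a b => tens a (c *: b)).

Fact tscale_biadditive c : biadditive (fun (a : A) (b : B) => tens a (c *: b)).
Proof.
by split=> [b a a'|a b b'] /=; rewrite ?scalerDr (tensDl, tensDr).
Qed.

Lemma tscaleE c a b : tscale c (tens a b) = tens a (c *: b).
Proof. by rewrite /tscale (tliftE _ _ (tscale_biadditive c)). Qed.

Fact tscaleB c : {morph tscale c : x y / x - y}.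
Proof. exact: (tlift_is_zmod_morphism (tscale_biadditive c)). Qed.

Fact tscale0 c : tscale c 0 = 0.
Proof. by have := tscaleB c 0 0; rewrite !subrr. Qed.

Fact tscaleA c d x : tscale c (tscale d x) = tscale (c * d) x.
Proof.
elim/tensor_ind: x => [|x y IHx IHy|a b]; first by rewrite !tscale0.
  by rewrite !tscaleB IHx IHy.
by rewrite !tscaleE scalerA.
Qed.

Fact tscale1 : left_id 1 tscale.
Proof.
elim/tensor_ind=> [|x y IHx IHy|a b]; first exact: tscale0.
  by rewrite tscaleB IHx IHy.
by rewrite tscaleE scale1r.
Qed.

Fact tscaleDr : right_distributive tscale +%R.
Proof.
move=> c x y; have tN z : tscale c (- z) = - tscale c z.
  by rewrite -sub0r tscaleB tscale0 sub0r.
by rewrite -[y in LHS]opprK tscaleB tN opprK.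
Qed.

Fact tscaleDl x : {morph tscale^~ x : c d / c + d}.
Proof.
move=> c d; elim/tensor_ind: x => [|x y IHx IHy|a b].
- by rewrite !tscale0 addr0.
- by rewrite !tscaleB IHx IHy opprD addrACA.
- by rewrite !tscaleE scalerDl tensDr.
Qed.

HB.instance Definition _ :=
  GRing.Zmodule_isLmodule.Build R (tensor A B) tscaleA tscale1 tscaleDr tscaleDl.

End TensorModule.

Section Dimension.
Variables (K : fieldType) (V : lmodType K).

Definition is_basis n (b : 'I_n -> V) : Prop :=
  (forall c : 'I_n -> K, \sum_(i < n) c i *: b i = 0 -> forall i, c i = 0) /\
  (forall v : V, exists c : 'I_n -> K, v = \sum_(i < n) c i *: b i).

(* The dimension of V if V is finite-dimensional, and the junk value 0
   otherwise. The group homology H_1(G, Q) is finite-dimensional for finitely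
   generated G, hence also for subgroups of finite index of such a G. *)
Definition dimension : nat :=
  xget 0%N [set n | exists b : 'I_n -> V, is_basis b]%classic.

End Dimension.

Definition rkQ (G : groupType) : nat :=
  dimension (tensor (abelianization G) rat^o).

(* Main.v *)
(* For C = G/U, it suffices to find a homomorphism from U to the rationals which
   is not invariant under G: restriction embeds Hom(G, Q) into the G-invariant
   part of Hom(U, Q). Such a homomorphism comes from a non-principal crossed
   homomorphism from G to the sum-zero functions on C.

   Crossed homomorphisms G -> k^X, for a finite G-set X, form the kernel of a
   matrix A over Z[G] evaluated on X. Residual freeness gives homomorphisms
   phi : G -> P to finite q-groups that are injective on any given finite set and
   factor through a free group. As phi varies, Lueck's approximation argument
   shows that the kernels of A on P x C and on P have asymptotically the same
   dimension relative to |P x C| and |P|. The kernel on P has dimension at least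
   2|P|, because a non-cyclic subgroup of P has two independent homomorphisms to
   Z/q, which lift to integral crossed homomorphisms of G since subgroups of free
   groups are projective. If every crossed homomorphism to the sum-zero functions
   on C were principal, the sum-zero part of the kernel on P x C would have
   dimension at most |P|(|C| - 1), by reduction modulo q and the fixed vectors of
   q-groups, and the two kernels could not be that close. *)
Require Import Defs.
From HB Require Import structures.
From mathcomp Require Import boolp classical_sets cardinality.
From mathcomp Require Import all_boot all_order all_fingroup all_algebra.
From mathcomp Require Import all_solvable all_field zify ring.
From mathcomp Require Import monoid.

Set Implicit Arguments.
Unset Strict Implicit.
Unset Printing Implicit Defensive.

(** * Kernels of integral Gram matrices from traces *)

(** The relations, the precision and the finite set on which [phi] has to be faithful are all fixed
    before [q] and [P] are chosen, and this order shapes the estimates. Finitely many relations of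
    [G] cut out exactly the rational crossed homomorphisms on [C], whereas on [P] they may leave a
    larger kernel, which a lower bound tolerates. Reduction modulo [q] can only enlarge a kernel: an
    upper bound on [P * C] tolerates this, and the one matrix on [C] keeps its rank once [q] is
    large. Traces on [P * C] and on [P] agree up to the factor |C| because the nontrivial elements
    involved move every point of both. With k the dimension of the kernel on [P] divided by |P|, the
    estimates read |C| k <= k + |C| - 1 up to a small error, so k is at most about 1; the second
    independent homomorphism contradicts this. Principal crossed homomorphisms are excluded by a
    normalization instead of a quotient: the sum of [dl (rep c)] over [c] has to vanish. For the
    principal one given by a sum-zero function f on G/U, this sum is |C| f. *)

Section SpectralCount.
Import Order.TTheory GRing.Theory Num.Theory.
Local Open Scope ring_scope.

Lemma bernoulli_decay (F : numFieldType) (t : F) (R : nat) :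
  0 <= t <= 1 -> (1 - t) ^+ R * (1 + t *+ R) <= 1.
Proof.
case/andP=> t0 t1.
have t10 : 0 <= 1 - t by rewrite subr_ge0.
have bern : 1 + t *+ R <= (1 + t) ^+ R.
  elim: R => [|R IHR]; first by rewrite mulr0n addr0.
  rewrite exprS; apply: le_trans (ler_wpM2l _ IHR); last by rewrite addr_ge0.
  rewrite mulrDl mul1r mulrSr mulrDr mulr1 addrA lerD2l lerDl.
  by rewrite mulr_ge0 ?mulrn_wge0.
apply: le_trans (ler_wpM2l (exprn_ge0 _ t10) bern) _.
rewrite -exprMn -subr_sqr expr1n.
by apply: exprn_ile1; rewrite ?lerBlDr ?lerDl ?exprn_ge0 // subr_ge0 expr_le1.
Qed.

(* The nonzero [lam i] have product at least 1, so at most [#|I| / j] of them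
   lie below [M ^- j]; the others contribute little to the sum because [R] is
   large compared with [M ^ j.+1]. *)
Lemma eigenvalue_count (M j : nat) (I : finType) (lam : I -> algC) :
    (1 < M)%N -> (0 < j)%N ->
    (forall i, 0 <= lam i <= M%:R) ->
    1 <= \prod_(i | lam i != 0) lam i ->
  let R := (j * M ^ j.+1)%N in let z := #|[pred i | lam i == 0]| in
  (z * M ^ R)%:R <= \sum_i (M%:R - lam i) ^+ R /\
  j%:R * \sum_i (M%:R - lam i) ^+ R <= (M ^ R * (j * z + 2 * #|I|))%:R.
Proof.
move=> M1 j0 lamM prod1 R z.
have M0 : 0 < M%:R :> algC by rewrite ltr0n ltnW.
have le0 i : 0 <= M%:R - lam i by rewrite subr_ge0; case/andP: (lamM i).
have leM i : M%:R - lam i <= M%:R by rewrite lerBlDr lerDl; case/andP: (lamM i).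
split.
  rewrite natrM natrX mulr_natl -sumr_const.
  rewrite [leRHS](bigID [pred i | lam i == 0]) /= -[leLHS]addr0 lerD //.
    by apply: ler_sum => i /eqP ->; rewrite subr0.
  by apply: sumr_ge0 => i _; rewrite exprn_ge0.
pose e : algC := M%:R ^- j.
have e0 : 0 < e by rewrite invr_gt0 exprn_gt0.
pose small := [pred i | (lam i != 0) && (lam i < e)].
(* With k small nonzero values, the product of all nonzero ones is at most
   [M ^- (j * k) * M ^ #|I|]; as it is at least 1, [j * k <= #|I|]. *)
have jk : (j * #|small| <= #|I|)%N.
  rewrite -(leq_exp2l _ _ M1) -(@ler_nat algC) !natrX.
  rewrite exprM -[leLHS]mulr1.
  apply: le_trans (ler_wpM2l _ prod1) _; first by rewrite !exprn_ge0 // ltW.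
  rewrite (bigID small) /= mulrA.
  rewrite -[leRHS]mul1r ler_pM //.
  - apply: mulr_ge0; first by rewrite !exprn_ge0 // ltW.
    by apply: prodr_ge0 => i _; case/andP: (lamM i).
  - by apply: prodr_ge0 => i _; case/andP: (lamM i).
  - have -> : (M%:R ^+ j) ^+ #|small| = e ^- #|small| by rewrite -exprVn invrK.
    rewrite -ler_pdivlMl; last by rewrite invr_gt0 exprn_gt0.
    rewrite invrK mulr1 -prodr_const [leRHS](eq_bigl (fun i => (lam i != 0) && small i)).
      by apply: ler_prod => i /andP[_ /andP[_ /ltW->]]; case/andP: (lamM i) => ->.
    by move=> i; rewrite !inE; case: (lam i == 0).
  rewrite -prodr_const [leRHS](bigID (fun i => (lam i != 0) && ~~ small i)) /=.
  rewrite -[leLHS]mulr1 ler_pM //.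
  - by apply: prodr_ge0 => i _; case/andP: (lamM i).
  - by apply: ler_prod => i _; exact: lamM.
  elim/big_ind: _ => [|x y x1 y1|_ _] //; last by rewrite ler1n ltnW.
  by rewrite -[1]mulr1 ler_pM.
(* A value that is not small is at least [e = M * t], and [R] is chosen so that [t *+ R = j]: the
   decay of [(1 - t) ^+ R] then absorbs the factor [j]. *)
pose t : algC := (M%:R ^+ j.+1)^-1.
have t01 : 0 <= t <= 1.
  by rewrite invr_ge0 exprn_ge0 ?(ltW M0) //= invf_le1 ?exprn_gt0 // exprn_ege1 // ler1n ltnW.
have large i : lam i != 0 -> ~~ small i -> j%:R * (M%:R - lam i) ^+ R <= M%:R ^+ R.
  move=> nz; rewrite inE nz /= -real_leNgt; last 2 first.
  - exact: gtr0_real.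
  - by apply: ger0_real; case/andP: (lamM i).
  move=> ei; have : M%:R - lam i <= M%:R * (1 - t).
    rewrite mulrBr mulr1 lerD2l lerN2; apply: le_trans ei.
    by rewrite /t /e exprS invfM mulrA divff ?mul1r // gt_eqF.
  move=> h; apply: le_trans (_ : j%:R * (M%:R * (1 - t)) ^+ R <= _).
    by rewrite ler_wpM2l // lerXn2r // nnegrE // mulr_ge0 ?(ltW M0) // subr_ge0; case/andP: t01.
  rewrite exprMn mulrCA -[leRHS]mulr1 ler_wpM2l ?exprn_ge0 ?(ltW M0) //.
  apply: le_trans (bernoulli_decay R t01).
  rewrite mulrC ler_wpM2l //.
    by rewrite exprn_ge0 // subr_ge0; case/andP: t01.
  rewrite /R mulnC mulrnA -mulr_natr -[t *+ _]mulr_natr natrX mulVf ?mul1r ?lerDr //.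
  by rewrite expf_neq0 // gt_eqF.
rewrite mulr_sumr (bigID [pred i | lam i == 0]) /=.
rewrite [X in _ + X](bigID small) /=.
(* The zero values account for [j * z]; the small ones, being few, and the large ones, by decay,
   account for one [#|I|] each. *)
have -> : (M ^ R * (j * z + 2 * #|I|))%N =
   (z * (j * M ^ R) + (#|I| * M ^ R + #|I| * M ^ R))%N by ring.
rewrite !natrD; apply: lerD.
  rewrite natrM mulr_natl -sumr_const; apply: ler_sum => i /eqP ->.
  by rewrite subr0 natrM natrX.
apply: lerD.
  apply: le_trans (_ : ((j * #|small|) * M ^ R)%:R <= _); last first.
    by rewrite ler_nat leq_mul2r jk orbT.
  rewrite mulnAC mulnC natrM mulr_natl -sumr_const.
  rewrite [leRHS](eq_bigl (fun i => (lam i != 0) && small i)).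
    apply: ler_sum => i _; rewrite natrM natrX ler_wpM2l //.
    by rewrite lerXn2r // nnegrE // ltW.
  by move=> i; rewrite !inE; case: (lam i == 0).
rewrite natrM mulr_natl -sumr_const.
rewrite [leRHS](bigID (fun i => (lam i != 0) && ~~ small i)) /= -[leLHS]addr0.
apply: lerD; last by apply: sumr_ge0 => i _; rewrite ler0n.
by apply: ler_sum => i /andP[nz ns]; rewrite natrX large.
Qed.

End SpectralCount.

Section SpectralTrace.
Import Order.TTheory GRing.Theory Num.Theory Num.Def.
Local Open Scope ring_scope.
Local Open Scope sesquilinear_scope.

Definition nullity (F : fieldType) m n (A : 'M[F]_(m, n)) : nat := (m - \rank A)%N.

Lemma nullityE (F : fieldType) m n (A : 'M[F]_(m, n)) : nullity A = \rank (kermx A).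
Proof. by rewrite mxrank_ker. Qed.

Lemma rank_diag_mx (F : fieldType) n (d : 'rV[F]_n) :
  \rank (diag_mx d) = #|[pred i | d 0 i != 0]|.
Proof.
have -> : (diag_mx d :=: \sum_(i | d 0 i != 0) <<delta_mx (0 : 'I_1) i : 'rV[F]_n>>)%MS.
  apply/eqmxP/andP; split.
    apply/row_subP => i; rewrite row_diag_mx.
    have [->|nz] := eqVneq (d 0 i) 0; first by rewrite scale0r sub0mx.
    by apply: scalemx_sub; rewrite (sumsmx_sup i) // genmxE.
  apply/sumsmx_subP => i nz; rewrite genmxE.
  have -> : delta_mx 0 i = (d 0 i)^-1 *: row i (diag_mx d).
    by rewrite row_diag_mx scalerA mulVf ?scale1r.
  by rewrite scalemx_sub // row_sub.
have dx : mxdirect (\sum_(i | d 0 i != 0) <<delta_mx (0 : 'I_1) i : 'rV[F]_n>>)%MS.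
  apply/mxdirect_sumsP => i nz; apply/eqP/rowV0P => v.
  rewrite sub_capmx genmxE => /andP[/sub_rVP[a ->]] /sub_sumsmxP[u e].
  have /(congr1 (fun w : 'rV_n => w 0 i)) := e.
  rewrite !mxE !eqxx mulr1 summxE big1 => [->|k /andP[_ ki]]; first by rewrite scale0r.
  have /submxP[w ->] :
      (u k *m <<delta_mx (0 : 'I_1) k : 'rV[F]_n>> <= (delta_mx 0 k : 'rV[F]_n))%MS.
    by apply: submx_trans (submxMl _ _) _; rewrite genmxE.
  by rewrite mxE big1 // => l _; rewrite !mxE [i == k]eq_sym (negPf ki) andbF mulr0.
rewrite (mxdirectP dx) /= -sum1_card; apply: eq_big => i //= _.
by rewrite genmxE mxrank_delta.
Qed.

Lemma char_poly_similar (R : comUnitRingType) n (P D : 'M[R]_n) : P \in unitmx ->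
  char_poly (invmx P *m D *m P) = char_poly D.
Proof.
move=> uP; rewrite /char_poly /char_poly_mx !map_mxM /=.
set P' := map_mx _ P; set Q := map_mx _ (invmx P).
have QP : Q *m P' = 1%:M by rewrite -map_mxM mulVmx // map_mx1.
have -> : 'X%:M - Q *m map_mx polyC D *m P' = Q *m ('X%:M - map_mx polyC D) *m P'.
  by rewrite mulmxBr mulmxBl mul_mx_scalar -scalemxAl QP scalemx1.
rewrite !det_mulmx mulrC mulrA -det_mulmx.
by rewrite (mulmx1C QP) det1 mul1r.
Qed.

(** Applied to a characteristic polynomial: up to sign, the product of the nonzero eigenvalues is
    its lowest nonzero coefficient, hence an integer for an integral matrix. *)
Lemma coef_prod_zeros (F : fieldType) (I : finType) (lam : I -> F) :
  (\prod_i ('X - (lam i)%:P))`_#|[pred i | lam i == 0]| =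
  \prod_(i | lam i != 0) (- lam i).
Proof.
rewrite (bigID [pred i | lam i == 0]) /=.
rewrite (eq_bigr (fun=> 'X)) => [|i /eqP ->]; last by rewrite subr0.
rewrite prodr_const /= coefXnM ltnn subnn -horner_coef0 horner_prod.
by apply: eq_bigr => i _; rewrite !hornerE.
Qed.

(** [eigenvalue_count] is applied to the spectrum of the symmetric matrix [A *m A^T] over [algC].
    The Gram form makes the eigenvalues nonnegative, the row sums bound them by [M], and integrality
    makes the product of the nonzero ones at least 1. *)
Lemma gram_trace_bounds (M j n m : nat) (A : 'M[int]_(n, m)) :
    (1 < M)%N -> (0 < j)%N ->
    (forall i, \sum_k `|(A *m A^T) i k| <= M%:R) ->
  let R := (j * M ^ j.+1)%N in
  let z := nullity (map_mx intr A : 'M[rat]_(n, m)) in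
  let T := \tr ((M%:R%:M - A *m A^T) ^+ R) in
  (z * M ^ R)%:R <= T /\ j%:R * T <= (M ^ R * (j * z + 2 * n))%:R.
Proof.
move=> M1 j0 rowM R z T.
pose c := intr : int -> algC.
pose Ac := map_mx c A; pose Bc := Ac *m Ac^T.
have AcC : Ac ^ conjC = Ac.
  by apply/matrixP => i k; rewrite !mxE rmorph_int.
have Bct : Bc = Ac *m Ac ^t* by rewrite -[in RHS]map_trmx AcC.
have Bcsym : Bc^T = Bc by rewrite trmx_mul trmxK.
have Bcint : Bc = map_mx c (A *m A^T) by rewrite map_mxM -map_trmx.
have BcC : Bc ^ conjC = Bc.
  by rewrite Bcint; apply/matrixP => i k; rewrite !mxE rmorph_int.
have /orthomx_spectralP : Bc \is normalmx.
  by apply/normalmxP; rewrite -map_trmx BcC Bcsym.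
set P := spectralmx Bc; set sp := spectral_diag Bc => BcE.
have uP : P \in unitmx := spectral_unit Bc.
have PP : P *m P ^t* = 1%:M by apply/unitarymxP; exact: spectral_unitarymx.
have PB : P *m Bc = diag_mx sp *m P by rewrite {1}BcE !mulmxA mulmxV // mul1mx.
have rowPB i : row i P *m Bc = sp 0 i *: row i P.
  by rewrite -row_mul PB row_mul row_diag_mx -scalemxAl -rowE.
have sp0 i : 0 <= sp 0 i.
  have -> : sp 0 i = ((row i P *m Ac) *m (row i P *m Ac) ^t*) 0 0.
    rewrite trmx_mul map_mxM mulmxA -(mulmxA _ Ac) -Bct rowPB -scalemxAl mxE.
    have /(congr1 (fun X : 'M_n => X i i)) := PP.
    rewrite !mxE eqxx => e; rewrite -[LHS]mulr1; congr (_ * _).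
    by rewrite -[LHS]e; apply: eq_bigr => k _; rewrite !mxE.
  by rewrite mxE; apply: sumr_ge0 => k _; rewrite !mxE -normCK exprn_ge0.
have spM i : sp 0 i <= M%:R.
  (* The eigenvector equation is read at a coordinate of largest modulus. *)
  have [k vk kmax] : exists2 k, P i k != 0 & forall l, `|P i l| <= `|P i k|.
    have [k0 nz] : exists k, P i k != 0.
      apply/existsP; apply: contraT; rewrite negb_exists => /forallP h.
      have : row i P = 0 by apply/rowP => k; rewrite !mxE; apply/eqP; rewrite -[_ == _]negbK h.
      move=> r0; have /eqP := congr1 (fun X : 'M_n => X i i) PP.
      rewrite !mxE eqxx big1 ?[0 == _]eq_sym ?oner_eq0 // => k _.
      by move/rowP/(_ k): r0; rewrite !mxE => ->; rewrite mul0r.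
    have : exists k, forall l, `|P i l| <= `|P i k|.
      suff /(_ (enum 'I_n)) [k h] : forall s : seq 'I_n,
          exists k, forall l, l \in s -> `|P i l| <= `|P i k|.
        by exists k => l; apply: h; rewrite mem_enum.
      elim=> [|l s [k h]]; first by exists k0.
      have /orP[le|le] := real_leVge (normr_real (P i l)) (normr_real (P i k)).
        by exists k => t; rewrite inE => /orP[/eqP->|/h].
      by exists l => t; rewrite inE => /orP[/eqP->|/h/le_trans] //; apply.
    case=> k h; exists k => //; rewrite -normr_gt0; apply: lt_le_trans (h k0).
    by rewrite normr_gt0.
  have := congr1 (fun X : 'rV_n => `|X 0 k|) (rowPB i).
  rewrite mxE [X in _ = `|X|]mxE normrM (ger0_norm (sp0 i)) [row i P 0 k]mxE => e.
  rewrite -(@ler_pM2r _ `|P i k|) ?normr_gt0 // -e.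
  apply: le_trans (ler_norm_sum _ _ _) _.
  apply: le_trans (_ : \sum_l `|P i k| * `|Bc k l| <= _).
    apply: ler_sum => l _; rewrite normrM mxE ler_pM //.
    by rewrite -[Bc in leLHS]Bcsym mxE.
  rewrite -mulr_sumr mulrC ler_wpM2r // Bcint.
  have := rowM k; rewrite -(ler_int algC) rmorph_sum /= rmorph_nat.
  by apply: le_trans; apply: ler_sum => l _; rewrite mxE intr_norm.
pose lam i := sp 0 i.
have charB : char_poly Bc = \prod_i ('X - (lam i)%:P).
  by rewrite BcE char_poly_similar // char_poly_trig ?diag_mx_is_trig //;
     apply: eq_bigr => i _; rewrite mxE eqxx mulr1n.
have prod1 : 1 <= \prod_(i | lam i != 0) lam i.
  have -> : \prod_(i | lam i != 0) lam i = `|\prod_(i | lam i != 0) (- lam i)|.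
    by rewrite normr_prod; apply: eq_bigr => i _; rewrite normrN ger0_norm // sp0.
  have nz : \prod_(i | lam i != 0) (- lam i) != 0.
    by apply/prodf_neq0 => i nz; rewrite oppr_eq0.
  move: nz; rewrite -coef_prod_zeros -charB Bcint -map_char_poly coef_map /= /c.
  by rewrite intr_eq0 -intr_norm ler1z -gtz0_ge1 normr_gt0.
have zE : #|[pred i | lam i == 0]| = z.
  rewrite /z /nullity -(mxrank_map (@ratr algC)) -map_mx_comp.
  have -> : map_mx (ratr \o intr) A = Ac.
    by apply/matrixP => i k; rewrite !mxE /= ratr_int.
  (* [Ac] and its Gram matrix have the same left kernel: v Bc = 0 makes the squared norm of v Ac
     vanish. *)
  have -> : \rank Ac = \rank Bc.
    apply/eqP; rewrite eqn_leq mxrankM_maxl andbT.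
    have := mxrank_ker Ac; have := mxrank_ker Bc.
    have : (kermx Bc <= kermx Ac)%MS.
      apply/sub_kermxP/row_matrixP => i; rewrite row0.
      have : (row i (kermx Bc *m Ac)) *m (row i (kermx Bc *m Ac)) ^t* = 0.
        rewrite row_mul trmx_mul map_mxM mulmxA -(mulmxA _ Ac) -Bct.
        by rewrite -row_mul mulmx_ker row0 mul0mx.
      move: (row i _) => v v0; apply/rowP => k.
      move/(congr1 (fun X : 'M_1 => X 0 0)): v0; rewrite !mxE => /eqP.
      rewrite psumr_eq0 => [/allP/(_ k)|l _]; last by rewrite !mxE -normCK exprn_ge0.
      rewrite mem_index_enum !mxE -normCK expf_eq0 normr_eq0 => /(_ isT) /=.
      by move/eqP.
    move/mxrankS => h e1 e2; move: h; rewrite e1 e2.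
    by have := rank_leq_row Ac; have := rank_leq_row Bc; lia.
  have -> : \rank Bc = \rank (diag_mx sp).
    by rewrite BcE mxrankMfree ?row_free_unit // eqmxMfull // row_full_unit unitmx_inv.
  rewrite rank_diag_mx; have := cardC [pred i | sp 0 i != 0].
  rewrite card_ord => /(canRL (addKn _)) <-.
  by apply: eq_card => i; rewrite !inE negbK.
have trE : T%:~R = \sum_i (M%:R - lam i) ^+ R :> algC.
  have -> : T%:~R = \tr (map_mx c ((M%:R%:M - A *m A^T) ^+ R)) by rewrite /c trace_map_mx.
  have -> : map_mx c ((M%:R%:M - A *m A^T) ^+ R) = (M%:R%:M - Bc) ^+ R.
    elim: (R) => [|r IHr]; first by rewrite !expr0 map_mx1.
    by rewrite !exprS map_mxM IHr map_mxB -Bcint map_scalar_mx /c rmorph_nat.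
  have -> : (M%:R%:M - Bc) ^+ R = invmx P *m diag_mx (\row_i ((M%:R - lam i) ^+ R)) *m P.
    elim: (R) => [|r IHr].
      rewrite expr0 (_ : diag_mx _ = 1%:M) ?mulmx1 ?mulVmx //.
      by apply/matrixP => i k; rewrite !mxE expr0.
    have e1 : M%:R%:M - Bc = invmx P *m diag_mx (\row_i (M%:R - lam i)) *m P.
      rewrite (_ : diag_mx _ = M%:R%:M - diag_mx sp); last first.
        by apply/matrixP => i k; rewrite !mxE; case: eqP => [->|]; rewrite ?subr0.
      rewrite mulmxBr mulmxBl -BcE mul_mx_scalar -scalemxAl mulVmx //.
      by rewrite scalemx1.
    rewrite exprS IHr e1 -!mulmxE !mulmxA mulmxK // -(mulmxA _ (diag_mx _) (diag_mx _)) mulmx_diag.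
    by congr (_ *m diag_mx _ *m _); apply/rowP => i; rewrite !mxE exprS.
  rewrite -mulmxA mxtrace_mulC mulmxK // mxtrace_diag.
  by apply: eq_bigr => i _; rewrite mxE.
have lamM i : 0 <= lam i <= M%:R by rewrite sp0 spM.
have [h1 h2] := eigenvalue_count M1 j0 lamM prod1.
rewrite -/R zE card_ord -trE in h1 h2.
split; first by rewrite -(ler_int algC) rmorph_nat.
by rewrite -(ler_int algC) rmorphM /= !rmorph_nat.
Qed.

End SpectralTrace.

(** * Ranks modulo primes and p-groups acting in characteristic p *)

Section Ranks.
Import Order.TTheory GRing.Theory Num.Theory.
Local Open Scope group_scope.
Local Open Scope ring_scope.

(** A certificate for a lower bound on the rank that can be moved between the rationals, the
    integers and ['F_q]. *)
Lemma rank_geP (F : fieldType) m n (A : 'M[F]_(m, n)) r :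
  reflect (exists U : 'M_(r, m), exists V : 'M_(n, r), U *m A *m V = 1%:M)
          (r <= \rank A)%N.
Proof.
apply: (iffP idP) => [rA | [U [V e]]]; last first.
  rewrite -[r](mxrank1 F) -e.
  by apply: leq_trans (mxrankM_maxl _ _) (mxrankM_maxr _ _).
have /submxP[U0 eU] : (row_base A <= A)%MS by rewrite eq_row_base.
have /row_freeP[V0 eV] := row_base_free A.
exists (pid_mx r *m U0), (V0 *m pid_mx r).
rewrite -(mulmxA _ U0) -eU mulmxA -(mulmxA _ _ V0) eV mulmx1 pid_mx_id //.
exact: pid_mx_1.
Qed.

Lemma clear_denominators m n (A : 'M[rat]_(m, n)) :
  exists2 N : int, N != 0 & exists B : 'M[int]_(m, n), N%:~R *: A = map_mx intr B.
Proof.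
exists (\prod_(k : 'I_m * 'I_n) denq (A k.1 k.2)).
  by apply/prodf_neq0 => k _; rewrite denq_neq0.
exists (\matrix_(i, j) (numq (A i j) * \prod_(k | k != (i, j)) denq (A k.1 k.2))).
apply/matrixP => i j; rewrite !mxE (bigD1 (i, j)) //= !rmorphM /= numqE.
by rewrite mulrAC [_%:~R * A i j]mulrC.
Qed.

(** A certificate modulo [q] lifts to integer matrices whose product has determinant nonzero modulo
    [q], hence nonzero. *)
Lemma mxrank_modp_le q m n (A : 'M[int]_(m, n)) : prime q ->
  (\rank (map_mx intr A : 'M['F_q]_(m, n)) <= \rank (map_mx intr A : 'M[rat]_(m, n)))%N.
Proof.
move=> q_pr; set r := \rank _.
have /rank_geP[U [V e]] := leqnn r.
have lift a b (X : 'M['F_q]_(a, b)) : exists Y : 'M[int]_(a, b), map_mx intr Y = X.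
  exists (map_mx (fun x : 'F_q => (x : nat)%:Z) X).
  by apply/matrixP => i j; rewrite !mxE -pmulrn natr_Zp.
have [U' eU] := lift _ _ U; have [V' eV] := lift _ _ V.
have nz : \det (U' *m A *m V') != 0.
  apply: contra_neq (oner_neq0 'F_q) => d0.
  by rewrite -(det1 _ r) -e -eU -eV -!map_mxM det_map_mx d0 rmorph0.
have uM : (map_mx intr U' *m map_mx intr A *m map_mx intr V' : 'M[rat]_r) \in unitmx.
  by rewrite -!map_mxM unitmxE det_map_mx unitfE intr_eq0.
apply/rank_geP; exists (map_mx intr U').
by exists (map_mx intr V' *m invmx (map_mx intr U' *m map_mx intr A *m map_mx intr V'));
   rewrite mulmxA mulmxV.
Qed.

(** The denominators of a rational certificate are invertible modulo every larger prime. *)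
Lemma mxrank_modp_eq m n (A : 'M[int]_(m, n)) : exists N : nat,
  forall q, prime q -> (N < q)%N ->
  \rank (map_mx intr A : 'M['F_q]_(m, n)) = \rank (map_mx intr A : 'M[rat]_(m, n)).
Proof.
set r := \rank _ : nat.
have /rank_geP[U [V e]] := leqnn r.
have [a a0 [U' eU]] := clear_denominators U.
have [b b0 [V' eV]] := clear_denominators V.
exists (absz (a * b)) => q q_pr ltq; apply/eqP; rewrite eqn_leq mxrank_modp_le //=.
have e' : U' *m A *m V' = (a * b)%:M.
  have inj : injective (map_mx (intr : int -> rat) : 'M_r -> 'M_r).
    by move=> X Y /matrixP XY; apply/matrixP => i k; have := XY i k; rewrite !mxE => /intr_inj.
  apply: inj; rewrite !map_mxM -eU -eV -!scalemxAl -scalemxAr e scalerA scalemx1.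
  by rewrite map_scalar_mx rmorphM.
have nz : (a * b)%:~R != 0 :> 'F_q.
  have ab0 : (0 < absz (a * b)%R)%N by rewrite absz_gt0 mulf_neq0.
  suff: (absz (a * b))%:R != 0 :> 'F_q.
    by apply: contra_neq => ab; rewrite pmulrn abszE; case: ger0P => _;
       rewrite ?rmorphN /= ab ?oppr0.
  rewrite -(dvdn_pcharf (pchar_Fp q_pr)).
  by apply: contraL ltq => /(dvdn_leq ab0); rewrite -leqNgt.
apply/rank_geP; exists ((a * b)%:~R^-1 *: map_mx intr U'), (map_mx intr V').
rewrite -!scalemxAl -!map_mxM e' map_scalar_mx -scalemx1 scalerA mulVf //.
by rewrite scale1r.
Qed.

(** Each passage from Y T^i to Y T^(i+1) loses at most the dimension of [Y :&: kermx T], and nothing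
    is left after [e] of them. *)
Lemma nilpotent_rank_bound (F : fieldType) n (T : 'M[F]_n) e m (Y : 'M_(m, n)) :
    (Y *m T <= Y)%MS -> Y *m T ^+ e = 0 ->
  (\rank Y <= e * \rank (Y :&: kermx T)%MS)%N.
Proof.
elim: e m Y => [|e IHe] m Y sY nY.
  by rewrite expr0 mulmx1 in nY; rewrite nY mxrank0.
rewrite -(mxrank_mul_ker Y T) mulSn addnC leq_add2l.
apply: leq_trans (IHe _ _ _ _) _.
- by rewrite submxMr.
- by rewrite -mulmxA mulmxE -exprS.
by rewrite leq_mul2l mxrankS ?orbT // capmxS.
Qed.

Lemma expr_sub1_pchar (F : fieldType) q n (A : 'M[F]_n) : q \in [pchar F] ->
  (A - 1%:M) ^+ q = A ^+ q - 1%:M.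
Proof.
case: n A => [|n] A qF; first by apply/matrixP => - [].
have qM : q \in [pchar 'M[F]_n.+1] by rewrite pchar_lalg.
rewrite -(pFrobenius_autE qM) pFrobenius_autB_comm; last exact: commr1.
by rewrite !pFrobenius_autE expr1n.
Qed.

(* Pass to a maximal subgroup [N], which is normal of index [q]; on the [N]-fixed
   vectors, [rho t - 1] with [t] outside [N] is nilpotent of order at most [q]. *)
Lemma pgroup_rank_bound (F : fieldType) q (gT : finGroupType) n
    (rho : gT -> 'M[F]_n) :
    prime q -> q \in [pchar F] -> rho 1%g = 1%:M ->
    (forall x y, rho (x * y)%g = rho x *m rho y) ->
  forall (P : {group gT}), (q.-group P)%g ->
  forall m (W : 'M_(m, n)), (forall x, x \in P -> (W *m rho x <= W)%MS) ->
  forall r (Z : 'M_(r, n)),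
    (forall v : 'rV_n, (v <= W)%MS -> (forall x, x \in P -> v *m rho x = v) ->
       (v <= Z)%MS) ->
  (\rank W <= #|P| * \rank Z)%N.
Proof.
move=> q_pr qF rho1 rhoM P; have [s] := ubnP #|P|; elim: s P => // s IHs P leP qP.
move=> m W stW r Z fixZ.
have [P1|ntP] := eqsVneq P 1%g.
  rewrite P1 cards1 mul1n; apply: mxrankS; apply/rV_subP => v vW.
  by apply: fixZ => // x; rewrite P1 inE => /eqP->; rewrite rho1 mulmx1.
have [N maxN] : {N : {group gT} | maximal N P}.
  have [//|N mN _] := @maxgroup_exists _ (fun H : {group gT} => H \proper P) 1%G.
    by rewrite properE sub1G /= subG1.
  by exists N.
have nN : N <| P := p_maximal_normal qP maxN.
have iN : #|P : N| = q := p_maximal_index qP maxN.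
have sNP := normal_sub nN.
have cardP : #|P| = (#|N| * q)%N by rewrite -(Lagrange sNP) iN.
have /properP[_ [t tP tN]] : N \proper P by exact: maxgroupp maxN.
pose W1 := (W :&: \bigcap_(x in N) kermx (rho x - 1%:M))%MS.
have W1P (v : 'rV_n) : reflect ((v <= W)%MS /\ forall x, x \in N -> v *m rho x = v) (v <= W1)%MS.
  rewrite sub_capmx; apply: (iffP andP) => -[vW h]; split => //.
    move=> x xN; move/sub_bigcapmxP/(_ x xN)/sub_kermxP: h.
    by rewrite mulmxBr mulmx1 => /eqP; rewrite subr_eq0 => /eqP.
  by apply/sub_bigcapmxP => x xN; apply/sub_kermxP; rewrite mulmxBr mulmx1 h ?subrr.
have rkW : (\rank W <= #|N| * \rank W1)%N.
  apply: IHs (pgroupS sNP qP) _ _ _ _ _ _.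
  - rewrite -ltnS; apply: leq_trans leP; rewrite ltnS cardP ltn_Pmulr ?prime_gt1 //.
  - by move=> x xN; apply: stW; apply: subsetP xN.
  - by move=> v vW h; apply/W1P.
rewrite cardP -mulnA; apply: leq_trans rkW _; rewrite leq_mul2l; apply/orP; right.
have stW1 x : x \in P -> (W1 *m rho x <= W1)%MS.
  move=> xP; apply/rV_subP => v /submxP[u ->]; rewrite mulmxA.
  have /W1P[uW fixu] : (u *m W1 <= W1)%MS by apply: submxMl.
  apply/W1P; split; first exact: submx_trans (submxMr _ uW) (stW x xP).
  move=> y yN; have yxN : (y ^ x^-1)%g \in N.
    by rewrite memJ_norm // groupV (subsetP (normal_norm nN)).
  by rewrite -mulmxA -rhoM conjgCV rhoM mulmxA fixu.
have tq : (t ^+ q)%g \in N.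
  rewrite -iN -card_quotient ?normal_norm //.
  have tNN : t \in 'N(N)%g by rewrite (subsetP (normal_norm nN)).
  apply: coset_idr; rewrite ?groupX // morphX //=.
  by apply: expg_cardG; rewrite mem_quotient.
pose T := rho t - 1%:M.
(* In characteristic [q], [T ^+ q = rho (t ^+ q) - 1], and [t ^+ q] lies in [N], which fixes
   [W1]. *)
have nT : W1 *m T ^+ q = 0.
  rewrite (expr_sub1_pchar _ qF) mulmxBr mulmx1.
  have -> : rho t ^+ q = rho (t ^+ q)%g.
    by elim: (q) => [|e IHe]; rewrite ?expr0 ?rho1 // exprS IHe expgS rhoM.
  apply/eqP; rewrite subr_eq0; apply/eqP/row_matrixP => i; rewrite row_mul.
  by have /W1P[_ ->] := row_sub i W1.
apply: leq_trans (nilpotent_rank_bound _ nT) _.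
  by rewrite mulmxBr mulmx1 addmx_sub ?stW1 // eqmx_opp.
rewrite leq_mul2l mxrankS ?orbT //; apply/rV_subP => v; rewrite sub_capmx.
case/andP=> /W1P[vW fixv] /sub_kermxP; rewrite mulmxBr mulmx1 => /eqP.
rewrite subr_eq0 => /eqP vt.
(* The stabilizer of [v] contains [N] and [t], so it is [P] by maximality of [N]. *)
pose S := [set x in P | v *m rho x == v].
have gS : group_set S.
  apply/group_setP; rewrite !inE group1 rho1 mulmx1 eqxx; split=> // x y.
  rewrite !inE => /andP[xP /eqP vx] /andP[yP /eqP vy].
  by rewrite groupM // rhoM mulmxA vx vy eqxx.
have sNS : N \subset group gS.
  by apply/subsetP => x xN; rewrite !inE (subsetP sNP) // fixv ?eqxx.
have /maximal_eqP[_ /(_ (group gS) sNS)] : maximal_eq N P by rewrite /maximal_eq maxN orbT.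
case=> [||eS].
- by apply/subsetP => x; rewrite inE => /andP[].
- by move=> /setP/(_ t); rewrite (negPf tN) !inE tP vt eqxx.
apply: fixZ => // x; rewrite -eS inE => /andP[_ /eqP //].
Qed.
End Ranks.

(** * Matrices over the group ring and their traces on finite G-sets *)

Section FunctionMatrices.
Import GRing.Theory.
Local Open Scope ring_scope.

Definition fmx (R : Type) (I J : finType) (f : I -> J -> R) : 'M[R]_(#|I|, #|J|) :=
  \matrix_(i, j) f (enum_val i) (enum_val j).

Definition frow (R : Type) (I : finType) (u : I -> R) : 'rV[R]_#|I| :=
  \row_i u (enum_val i).

Lemma frowE (R : Type) (I : finType) (u : I -> R) i :
  frow u 0 (enum_rank i) = u i.
Proof. by rewrite mxE enum_rankK. Qed.

Lemma frow_eta (R : Type) (I : finType) (v : 'rV[R]_#|I|) :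
  v = frow (fun i => v 0 (enum_rank i)).
Proof. by apply/rowP => i; rewrite mxE enum_valK. Qed.

Lemma frow_inj (R : Type) (I : finType) (u w : I -> R) : frow u = frow w -> u =1 w.
Proof. by move=> e i; rewrite -(frowE u i) e frowE. Qed.

Lemma frow0P (R : nmodType) (I : finType) (u : I -> R) : frow u = 0 -> u =1 fun=> 0.
Proof. by move=> u0 i; rewrite -(frowE u) u0 mxE. Qed.

Lemma eq_frow (R : Type) (I : finType) (u w : I -> R) : u =1 w -> frow u = frow w.
Proof. by move=> e; apply/rowP => i; rewrite !mxE e. Qed.

Lemma sum_enum_val (R : nmodType) (J : finType) (F : J -> R) :
  \sum_(k < #|J|) F (enum_val k) = \sum_j F j.
Proof.
rewrite (reindex (@enum_val J J)) /=; first by [].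
by exists enum_rank => k _; rewrite ?enum_rankK ?enum_valK.
Qed.

Lemma fmx_mul (R : pzSemiRingType) (I J K : finType) (f : I -> J -> R) (g : J -> K -> R) :
  fmx f *m fmx g = fmx (fun i k => \sum_j f i j * g j k).
Proof.
apply/matrixP => i k; rewrite !mxE -[RHS]sum_enum_val.
by apply: eq_bigr => j _; rewrite !mxE.
Qed.

Lemma frow_mul (R : pzSemiRingType) (I J : finType) (u : I -> R) (g : I -> J -> R) :
  frow u *m fmx g = frow (fun k => \sum_i u i * g i k).
Proof.
apply/rowP => k; rewrite !mxE -[RHS]sum_enum_val.
by apply: eq_bigr => j _; rewrite !mxE.
Qed.

Lemma fmx_tr (R : Type) (I J : finType) (f : I -> J -> R) :
  (fmx f)^T = fmx (fun j i => f i j).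
Proof. by apply/matrixP => i k; rewrite !mxE. Qed.

Lemma fmx_trace (R : pzSemiRingType) (I : finType) (f : I -> I -> R) :
  \tr (fmx f) = \sum_i f i i.
Proof. by rewrite -[RHS]sum_enum_val; apply: eq_bigr => j _; rewrite mxE. Qed.

Lemma map_fmx (R S : Type) (h : R -> S) (I J : finType) (f : I -> J -> R) :
  map_mx h (fmx f) = fmx (fun i j => h (f i j)).
Proof. by apply/matrixP => i k; rewrite !mxE. Qed.

Lemma eq_fmx (R : Type) (I J : finType) (f g : I -> J -> R) : f =2 g -> fmx f = fmx g.
Proof. by move=> e; apply/matrixP => i k; rewrite !mxE e. Qed.

Lemma scalar_fmx (R : pzSemiRingType) (I : finType) (c : R) :
  c%:M = fmx (fun i j : I => c *+ (i == j)).
Proof. by apply/matrixP => i k; rewrite !mxE (inj_eq enum_val_inj). Qed.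

End FunctionMatrices.

Section GroupRingMatrices.
Import Order.TTheory GRing.Theory Num.Theory.
Local Open Scope group_scope.
Local Open Scope ring_scope.
Variable G : groupType.

Definition is_act (Om : Type) (act : G -> Om -> Om) : Prop :=
  (forall w, act 1%g w = w) /\ (forall g h w, act (g * h)%g w = act g (act h w)).

(* A matrix over the integral group ring of [G], with rows indexed by [D] and
   columns by [E], is a formal sum of terms [(c, g, (i, j))], meaning [c g] in
   position [(i, j)]. *)
Definition grmx (D E : Type) := seq (int * G * (D * E)).

(** Row vectors are multiplied by [t] first, so the element from [t] acts first and the group
    elements multiply in reverse order. Terms whose positions do not match are kept with coefficient
    0. *)
Definition gr_mul (D : Type) (E : eqType) (F : Type) (t : grmx D E) (t' : grmx E F) : grmx D F :=
  [seq (x.1.1 * y.1.1 *+ (x.2.2 == y.2.1), (y.1.2 * x.1.2)%g, (x.2.1, y.2.2)) | x <- t, y <- t'].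

Definition gr_adj (D E : Type) (t : grmx D E) : grmx E D :=
  [seq (x.1.1, x.1.2^-1%g, (x.2.2, x.2.1)) | x <- t].

Definition gr_opp (D E : Type) (t : grmx D E) : grmx D E :=
  [seq (- x.1.1, x.1.2, x.2) | x <- t].

Definition gr_scalar (D : finType) (c : int) : grmx D D :=
  [seq (c, 1%g, (i, i)) | i <- enum D].

Fixpoint gr_exp (D : finType) (t : grmx D D) (n : nat) : grmx D D :=
  if n is n'.+1 then gr_mul t (gr_exp t n') else gr_scalar D 1.

Definition gr_norm (D E : Type) (t : grmx D E) : nat := \sum_(x <- t) absz x.1.1.

Section Evaluation.
Variables (Om : finType) (act : G -> Om -> Om) (actP : is_act act).

Definition gr_ev (D E : finType) (t : grmx D E) (a : D * Om) (b : E * Om) : int :=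
  \sum_(x <- t) x.1.1 *+ [&& a.1 == x.2.1, b.1 == x.2.2 & b.2 == act x.1.2 a.2].

Lemma actK g : cancel (act g) (act g^-1%g).
Proof. by move=> w; rewrite -actP.2 mulVg actP.1. Qed.

Lemma actVK g : cancel (act g^-1%g) (act g).
Proof. by move=> w; rewrite -actP.2 mulgV actP.1. Qed.

Lemma gr_ev_cat (D E : finType) (t t' : grmx D E) a b :
  gr_ev (t ++ t') a b = gr_ev t a b + gr_ev t' a b.
Proof. by rewrite /gr_ev big_cat. Qed.

Lemma gr_ev_opp (D E : finType) (t : grmx D E) a b :
  gr_ev (gr_opp t) a b = - gr_ev t a b.
Proof.
rewrite /gr_ev big_map -sumrN; apply: eq_bigr => x _ /=.
by rewrite mulNrn.
Qed.

Lemma gr_ev_adj (D E : finType) (t : grmx D E) a b :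
  gr_ev (gr_adj t) b a = gr_ev t a b.
Proof.
rewrite /gr_ev big_map; apply: eq_bigr => x _ /=; congr (_ *+ nat_of_bool _).
rewrite andbCA; congr [&& _, _ & _].
by apply/eqP/eqP => ->; rewrite ?actK ?actVK.
Qed.

Lemma gr_ev_scalar (D : finType) c (a b : D * Om) :
  gr_ev (gr_scalar D c) a b = c *+ (a == b).
Proof.
rewrite /gr_ev big_map big_enum /= (bigD1 a.1) //= big1 => [|i].
  rewrite eqxx addr0 actP.1; congr (_ *+ nat_of_bool _).
  by rewrite -pair_eqE /= ![b.1 == _]eq_sym ![b.2 == _]eq_sym.
by rewrite eq_sym => /negPf ->.
Qed.

Lemma gr_ev_mul (D E F : finType) (t : grmx D E) (t' : grmx E F) a b :
  \sum_k gr_ev t a k * gr_ev t' k b = gr_ev (gr_mul t t') a b.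
Proof.
rewrite /gr_ev big_allpairs_dep /=.
under eq_bigr do rewrite mulr_suml.
rewrite exchange_big /=; apply: eq_bigr => x _.
under eq_bigr do rewrite mulr_sumr.
rewrite exchange_big /=; apply: eq_bigr => y _.
rewrite (bigD1 (x.2.2, act x.1.2 a.2)) //= !eqxx !andbT big1 ?addr0.
  rewrite mulrnAl mulrnAr -!mulrnA; congr (_ *+ _).
  by rewrite actP.2; do !case: (_ == _).
move=> [k w]; rewrite -pair_eqE /= => /negPf e.
by rewrite e andbF mulr0n mul0r.
Qed.

Lemma fmx_gr_mul (D E F : finType) (t : grmx D E) (t' : grmx E F) :
  fmx (gr_ev t) *m fmx (gr_ev t') = fmx (gr_ev (gr_mul t t')).
Proof. by rewrite fmx_mul; apply: eq_fmx => a b; rewrite gr_ev_mul. Qed.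

Lemma fmx_gr_exp (D : finType) (t : grmx D D) n :
  fmx (gr_ev t) ^+ n = fmx (gr_ev (gr_exp t n)).
Proof.
elim: n => [|n IHn]; last by rewrite exprS IHn -fmx_gr_mul.
rewrite expr0 -[LHS]/(1%:M) scalar_fmx.
by apply: eq_fmx => a b; rewrite gr_ev_scalar.
Qed.

(** The trace sees the G-set only through the numbers of fixed points of the finitely many group
    elements occurring in [t]. *)
Lemma gr_ev_trace (D : finType) (t : grmx D D) :
  \tr (fmx (gr_ev t)) =
  \sum_(x <- t) x.1.1 *+ ((x.2.1 == x.2.2) * #|[pred w | act x.1.2 w == w]|).
Proof.
rewrite fmx_trace /gr_ev exchange_big /=; apply: eq_bigr => x _.
rewrite -(pair_bigA _ (fun i w => x.1.1 *+ [&& i == x.2.1, i == x.2.2 & w == act x.1.2 w])) /=.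
rewrite (bigD1 x.2.1) //= eqxx [X in _ + X]big1 ?addr0 => [|i /negPf e]; last first.
  by rewrite big1 // => w _; rewrite e.
rewrite sumrMnr; congr (_ *+ _); case: eqP => _ /=; last by rewrite big1.
by rewrite mul1n -sum1_card [RHS]big_mkcond; apply: eq_bigr => w _; rewrite inE eq_sym; case: eqP.
Qed.

(** The bound is independent of [Om], so that one [M] serves every G-set. *)
Lemma gr_ev_row_norm (D E : finType) (t : grmx D E) a :
  \sum_b `|gr_ev t a b| <= (gr_norm t)%:R.
Proof.
apply: le_trans (_ : \sum_b \sum_(x <- t) `|x.1.1| *+ (b == (x.2.2, act x.1.2 a.2)) <= _).
  apply: ler_sum => b _; apply: le_trans (ler_norm_sum _ _ _) _.
  apply: ler_sum => x _; rewrite normrMn; case: b => b1 b2; rewrite xpair_eqE /=.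
  by case: (a.1 == _) => //=; rewrite mulr0n mulrn_wge0.
rewrite exchange_big /= /gr_norm natr_sum; apply: ler_sum => x _.
rewrite (bigD1 (x.2.2, act x.1.2 a.2)) //= eqxx big1 => [|b /negPf -> //].
by rewrite addr0 mulr1n natz abszE.
Qed.

End Evaluation.

(* Lueck's approximation argument: the traces of the powers up to [R] of
   [M - A A^T] determine the dimension of the kernel of [A] up to a small
   proportion of the total dimension, because the nonzero eigenvalues of
   [A A^T] have an integral product. *)
Lemma nullity_comparison (D E : finType) (t : grmx D E) (j : nat) : (0 < j)%N ->
  exists S : seq G, forall (Om Om' : finType) act act' p,
    is_act act -> is_act act' ->
    (forall g, g \in S ->
       #|[pred w : Om' | act' g w == w]| = (p * #|[pred w : Om | act g w == w]|)%N) ->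
  (j * p * nullity (map_mx intr (fmx (gr_ev (Om:=Om) act t)) : 'M[rat]_(_, _)) <=
   j * nullity (map_mx intr (fmx (gr_ev (Om:=Om') act' t)) : 'M[rat]_(_, _))
   + 2 * (#|D| * #|Om'|))%N.
Proof.
move=> j0; pose B := gr_mul t (gr_adj t).
pose M := maxn 2 (gr_norm B).
have M1 : (1 < M)%N by rewrite leq_max.
pose R := (j * M ^ j.+1)%N.
pose T := gr_exp (gr_scalar D M%:R ++ gr_opp B) R.
(* The group elements in the expansion of the [R]-th power of M - A A^*: their fixed points
   determine the trace on every G-set. *)
exists [seq x.1.2 | x <- T] => Om Om' act act' p actP actP' fixP.
have gram (Om0 : finType) act0 (a0 : is_act act0) :
    fmx (gr_ev (Om := Om0) act0 t) *m (fmx (gr_ev act0 t))^T = fmx (gr_ev act0 B).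
  rewrite fmx_tr -fmx_gr_mul //; congr (_ *m _).
  by apply: eq_fmx => a b; rewrite gr_ev_adj.
have rowM (Om0 : finType) act0 (a0 : is_act act0) i :
    \sum_k `|(fmx (gr_ev (Om := Om0) act0 t) *m (fmx (gr_ev act0 t))^T) i k| <= M%:R.
  rewrite gram //; apply: le_trans (_ : (gr_norm B)%:R <= _); last first.
    by rewrite ler_nat leq_maxr.
  apply: le_trans (gr_ev_row_norm act0 B (enum_val i)).
  by rewrite -[leRHS]sum_enum_val; apply: ler_sum => k _; rewrite mxE.
have trT (Om0 : finType) act0 (a0 : is_act act0) :
    \tr ((M%:R%:M - fmx (gr_ev (Om := Om0) act0 t) *m (fmx (gr_ev act0 t))^T) ^+ R) =
    \sum_(x <- T) x.1.1 *+ ((x.2.1 == x.2.2) * #|[pred w | act0 x.1.2 w == w]|).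
  rewrite -gr_ev_trace // -fmx_gr_exp // gram //; congr (\tr (_ ^+ _)).
  apply/matrixP => i k; rewrite scalar_fmx !mxE gr_ev_cat gr_ev_opp gr_ev_scalar //.
have trp : \tr ((M%:R%:M - fmx (gr_ev act' t) *m (fmx (gr_ev act' t))^T) ^+ R) =
    p%:R * \tr ((M%:R%:M - fmx (gr_ev act t) *m (fmx (gr_ev act t))^T) ^+ R).
  rewrite !trT // mulr_sumr; apply: eq_big_seq => x xT.
  by rewrite fixP ?(map_f (fun y => y.1.2)) // mulnCA mulnC mulrnA mulr_natl.
have [h1 _] := gram_trace_bounds M1 j0 (rowM _ _ actP).
have [_ h2] := gram_trace_bounds M1 j0 (rowM _ _ actP').
move: h1 h2; rewrite trp -/R.
set z := nullity _; set z' := nullity _; set tr := \tr _ => h1 h2.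
have : (j * p * (z * M ^ R))%:R <= (M ^ R * (j * z' + 2 * #|{: D * Om'}|))%:R :> int.
  apply: le_trans h2; rewrite mulrA -natrM natrM ler_wpM2l //.
rewrite ler_nat mulnA mulnC leq_pmul2l ?expn_gt0 ?(ltnW M1) //.
by rewrite card_prod.
Qed.

End GroupRingMatrices.

(** * Kernels of evaluated matrices and sums over fibres *)

Section Kernels.
Import Order.TTheory GRing.Theory Num.Theory.
Local Open Scope group_scope.
Local Open Scope ring_scope.
Variable G : groupType.

Definition gr_apply (k : nzRingType) (Om D : Type) (E : eqType) (act : G -> Om -> Om)
    (t : grmx G D E) (m : D * Om -> k) (j : E) (w : Om) : k :=
  \sum_(x <- t | x.2.2 == j) x.1.1%:~R * m (x.2.1, act x.1.2^-1%g w).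

Definition gr_ker (k : nzRingType) (Om D : Type) (E : eqType) (act : G -> Om -> Om)
    (t : grmx G D E) (m : D * Om -> k) : Prop :=
  forall j w, gr_apply act t m j w = 0.

Definition gr_matrix (k : nzRingType) (Om D E : finType) (act : G -> Om -> Om)
    (t : grmx G D E) : 'M[k]_(#|{: D * Om}|, #|{: E * Om}|) :=
  map_mx intr (fmx (gr_ev act t)).

Lemma gr_evE (k : nzRingType) (Om D E : finType) (act : G -> Om -> Om)
    (t : grmx G D E) (m : D * Om -> k) j w : is_act act ->
  \sum_a m a * (gr_ev act t a (j, w))%:~R = gr_apply act t m j w.
Proof.
move=> actP; rewrite /gr_ev /gr_apply.
rewrite (eq_bigr (fun a => \sum_(x <- t) m a *
    (x.1.1 *+ [&& a.1 == x.2.1, j == x.2.2 & w == act x.1.2 a.2])%:~R)); last first.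
  by move=> a _; rewrite rmorph_sum mulr_sumr.
rewrite exchange_big /= [RHS]big_mkcond; apply: eq_bigr => x _.
rewrite (bigD1 (x.2.1, act x.1.2^-1%g w)) //= big1 => [|[i v] ne].
  rewrite eqxx (actVK actP) eqxx andbT addr0 [j == _]eq_sym; case: eqP => _ /=.
    by rewrite mulr1n mulrzr mulrzl.
  by rewrite mulr0n mulr0.
case: and3P => [[/eqP/= ei _ /eqP/= ew]|_]; last by rewrite mulr0n mulr0.
by move: ne; rewrite ei ew (actK actP) eqxx.
Qed.

Lemma gr_kerP (k : fieldType) (Om D E : finType) (act : G -> Om -> Om)
    (t : grmx G D E) (m : D * Om -> k) : is_act act ->
  (frow m <= kermx (gr_matrix k act t))%MS <-> gr_ker act t m.
Proof.
move=> actP; split=> [/sub_kermxP e j w | h].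
  rewrite -gr_evE //; move: e; rewrite /gr_matrix map_fmx frow_mul.
  by move/rowP/(_ (enum_rank (j, w))); rewrite frowE mxE.
apply/sub_kermxP; rewrite /gr_matrix map_fmx frow_mul.
apply/rowP => i; rewrite !mxE; case: (enum_val i) => j w.
by rewrite gr_evE.
Qed.

(* The rows of [gr_matrix] together with the conditions that the sums over the
   fibres of [pr] vanish. *)
Definition gr_aug (Om Om0 D E : finType) (act : G -> Om -> Om) (pr : Om -> Om0)
    (t : grmx G D E) (a : D * Om) (b : (E * Om) + (D * Om0)) : int :=
  match b with
  | inl b' => gr_ev act t a b'
  | inr b' => ((a.1, pr a.2) == b')%:R
  end.

Definition gr_aug_matrix (k : nzRingType) (Om Om0 D E : finType) (act : G -> Om -> Om)
    (pr : Om -> Om0) (t : grmx G D E) :=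
  map_mx (intr : int -> k) (fmx (gr_aug act pr t)).

Lemma fibre_sumE (k : nzRingType) (Om Om0 D : finType) (pr : Om -> Om0)
    (m : D * Om -> k) (b : D * Om0) :
  \sum_a m a * ((a.1, pr a.2) == b)%:R = \sum_(w | pr w == b.2) m (b.1, w).
Proof.
case: b => i y /=.
transitivity (\sum_j \sum_w m (j, w) * ((j, pr w) == (i, y))%:R).
  by rewrite pair_bigA; apply: eq_bigr => -[].
rewrite (bigD1 i) //= [X in _ + X]big1 => [|j /negPf ne]; last first.
  by apply: big1 => w _; rewrite xpair_eqE ne mulr0.
rewrite addr0 [RHS]big_mkcond; apply: eq_bigr => w _.
by rewrite xpair_eqE eqxx /=; case: eqP => _; rewrite ?mulr1 ?mulr0.
Qed.

Lemma gr_aug_kerP (k : fieldType) (Om Om0 D E : finType) (act : G -> Om -> Om)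
    (pr : Om -> Om0) (t : grmx G D E) (m : D * Om -> k) : is_act act ->
  (frow m <= kermx (gr_aug_matrix k act pr t))%MS <->
  gr_ker act t m /\ forall i y, \sum_(w | pr w == y) m (i, w) = 0.
Proof.
move=> actP; have intb (b : bool) : (b%:R : int)%:~R = b%:R :> k by case: b.
split=> [/sub_kermxP | [h1 h2]].
  rewrite /gr_aug_matrix map_fmx frow_mul => e; split=> [j w | i y].
    have /rowP/(_ (enum_rank (inl (j, w)))) := e.
    by rewrite frowE mxE /= gr_evE.
  have /rowP/(_ (enum_rank (inr (i, y)))) := e.
  rewrite frowE mxE => e'; apply: etrans e'; rewrite -(fibre_sumE pr m (i, y)).
  by apply: eq_bigr => a _; rewrite /gr_aug intb.
apply/sub_kermxP; rewrite /gr_aug_matrix map_fmx frow_mul.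
apply/rowP => b; rewrite !mxE; case: (enum_val b) => [[j w]|[i y]].
  by rewrite /= gr_evE.
rewrite -[RHS](h2 i y) -(fibre_sumE pr m (i, y)).
by apply: eq_bigr => a _; rewrite /gr_aug intb.
Qed.

Lemma frow_subP (k : fieldType) (I : finType) r r' (A : 'M[k]_(r, #|I|)) (B : 'M_(r', #|I|)) :
  (forall u : I -> k, (frow u <= A)%MS -> (frow u <= B)%MS) -> (A <= B)%MS.
Proof. by move=> h; apply/rV_subP => v; rewrite (frow_eta v); exact: h. Qed.

(** Summing over the fibres of [pr] is equivariant, so it maps the kernel on [Om] to the kernel on
    [Om0]; what it kills is the augmented kernel. *)
Lemma nullity_fibration (k : fieldType) (Om Om0 D E : finType)
    (act : G -> Om -> Om) (act0 : G -> Om0 -> Om0) (pr : Om -> Om0) (t : grmx G D E) :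
    is_act act -> is_act act0 -> (forall g w, pr (act g w) = act0 g (pr w)) ->
  (nullity (gr_matrix k act t) <=
   nullity (gr_matrix k act0 t) + nullity (gr_aug_matrix k act pr t))%N.
Proof.
move=> actP actP0 prP; rewrite !nullityE.
pose S : 'M[k]_(#|{: D * Om}|, #|{: D * Om0}|) := fmx (fun a b => ((a.1, pr a.2) == b)%:R).
have SE u : frow u *m S = frow (fun b => \sum_(w | pr w == b.2) u (b.1, w)).
  by rewrite frow_mul; apply: eq_frow => b; rewrite fibre_sumE.
rewrite -(mxrank_mul_ker (kermx (gr_matrix k act t)) S); apply: leq_add; apply: mxrankS.
  apply/rV_subP => v /submxP[c ->]; rewrite mulmxA.
  have : (c *m kermx (gr_matrix k act t) <= kermx (gr_matrix k act t))%MS by apply: submxMl.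
  move: (c *m _) => u; rewrite (frow_eta u) SE.
  set m := fun i => _; move/(gr_kerP _ _ actP) => km; apply/(gr_kerP _ _ actP0) => j y.
  transitivity (\sum_(w | pr w == y) gr_apply act t m j w); last by rewrite big1.
  rewrite /gr_apply exchange_big /=; apply: eq_bigr => x _; rewrite -mulr_sumr; congr (_ * _).
  rewrite (reindex (act x.1.2^-1%g)) /=.
    apply: eq_bigl => w; rewrite prP (inj_eq (can_inj (actVK actP0 _))) //.
  by exists (act x.1.2) => w _; rewrite ?(actK actP) ?(actVK actP).
apply: frow_subP => u; rewrite sub_capmx => /andP[/(gr_kerP _ _ actP) uk /sub_kermxP].
rewrite SE => uS; apply/gr_aug_kerP => //; split=> // i y.
exact: (frow0P uS (i, y)).
Qed.

End Kernels.

(** * Kernels on the product of a q-group and a G-set, in characteristic q *)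

Section PGroupExtension.
Import Order.TTheory GRing.Theory Num.Theory.
Local Open Scope group_scope.
Local Open Scope ring_scope.
Variable G : groupType.

Lemma frow_fun_mul (k : nzRingType) (I : finType) (s : I -> I) (u : I -> k) (s' : I -> I) :
  cancel s s' -> cancel s' s ->
  frow u *m fmx (fun a b => (b == s a)%:R) = frow (u \o s').
Proof.
move=> sK s'K; rewrite frow_mul; apply: eq_frow => b /=.
rewrite (bigD1 (s' b)) //= s'K eqxx mulr1 big1 ?addr0 // => a ne.
rewrite (_ : (b == s a) = false) ?mulr0 //; apply: contraNF ne => /eqP ->.
by rewrite sK.
Qed.

Lemma fmx_fun_mul (k : nzRingType) (I : finType) (s t : I -> I) :
  fmx (fun a b => (b == s a)%:R) *m fmx (fun a b => (b == t a)%:R) =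
  fmx (fun a b => (b == t (s a))%:R : k).
Proof.
rewrite fmx_mul; apply: eq_fmx => a c.
by rewrite (bigD1 (s a)) //= eqxx mul1r big1 ?addr0 // => b /negPf ->; rewrite mul0r.
Qed.

Definition mul_act (P : finGroupType) (phi : G -> P) (g : G) (z : P) : P := (phi g * z)%g.

Definition prod_act (Om C : Type) (act : G -> Om -> Om) (act' : G -> C -> C)
  (g : G) (w : Om * C) : Om * C := (act g w.1, act' g w.2).

Lemma mul_actP (P : finGroupType) (phi : G -> P) :
  (forall g h, phi (g * h)%g = (phi g * phi h)%g) -> is_act (mul_act phi).
Proof.
move=> phiM; have phi1 : phi 1%g = 1%g.
  by apply: (mulgI (phi 1%g)); rewrite -phiM !mulg1.
by split=> [z|g h z]; rewrite /mul_act ?phi1 ?mul1g // phiM mulgA.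
Qed.

Lemma prod_actP (Om C : Type) (act : G -> Om -> Om) (act' : G -> C -> C) :
  is_act act -> is_act act' -> is_act (prod_act act act').
Proof.
move=> a1 a2; split=> [[w c]|g h [w c]]; rewrite /prod_act /= ?a1.1 ?a2.1 //.
by rewrite a1.2 a2.2.
Qed.

(** Right translations of the factor [P] commute with [G] and preserve the augmented kernel. A
    vector fixed by all of them is constant along [P], hence comes from the augmented kernel on [C],
    and [pgroup_rank_bound] applies. *)
Lemma pgroup_nullity_bound (k : fieldType) q (P : finGroupType) (phi : G -> P)
    (C D E : finType) (act : G -> C -> C) (t : grmx G D E) :
    prime q -> q \in [pchar k] -> (q.-group [set: P])%g ->
    (forall g h, phi (g * h)%g = (phi g * phi h)%g) -> is_act act ->
  (nullity (gr_aug_matrix k (prod_act (mul_act phi) act) fst t) <=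
   #|P| * nullity (gr_aug_matrix k act (fun=> tt) t))%N.
Proof.
move=> q_pr qk qP phiM actC; set actP := prod_act _ _.
have actPP : is_act actP by apply: prod_actP => //; exact: mul_actP.
pose sh (y : P) (a : D * (P * C)) := (a.1, ((a.2.1 * y)%g, a.2.2)).
pose rho (y : P) : 'M[k]_#|{: D * (P * C)}| := fmx (fun a b => (b == sh y a)%:R).
have shK y : cancel (sh y) (sh y^-1%g) by case=> i [x c]; rewrite /sh /= mulgK.
have shVK y : cancel (sh y^-1%g) (sh y) by case=> i [x c]; rewrite /sh /= mulgVK.
have rhoE (u : D * (P * C) -> k) y : frow u *m rho y = frow (u \o sh y^-1%g).
  exact: frow_fun_mul.
pose W := kermx (gr_aug_matrix k actP fst t).
pose Pull : 'M[k]_(#|{: D * C}|, #|{: D * (P * C)}|) :=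
  fmx (fun a b => (a == (b.1, b.2.2))%:R).
pose Z := kermx (gr_aug_matrix k act (fun=> tt) t) *m Pull.
have rkZ : (\rank Z <= nullity (gr_aug_matrix k act (fun=> tt) t))%N.
  by rewrite nullityE mxrankM_maxl.
rewrite nullityE; apply: leq_trans (_ : #|P| * \rank Z <= _)%N; last first.
  by rewrite leq_mul2l rkZ orbT.
rewrite -[#|P|]cardsT; apply: (@pgroup_rank_bound k q P _ rho q_pr qk _ _ [set: P]%G qP).
- rewrite scalar_fmx; apply: eq_fmx => -[i [x c]] b.
  by rewrite /sh /= mulg1 eq_sym.
- move=> x y; rewrite fmx_fun_mul; apply: eq_fmx => -[i [z c]] b.
  by rewrite /sh /= mulgA.
- move=> y _; apply/rV_subP => v /submxP[c ->]; rewrite mulmxA.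
  have : (c *m W <= W)%MS by apply: submxMl.
  move: (c *m _) => u; rewrite (frow_eta u) rhoE.
  set m := fun i => _; move/(gr_aug_kerP _ _ _ actPP) => [km sm].
  apply/(gr_aug_kerP _ _ _ actPP); split=> [j [z c0]|i z].
    rewrite -[RHS](km j ((z * y^-1)%g, c0)); apply: eq_bigr => x _.
    by rewrite /actP /prod_act /mul_act /sh /= mulgA.
  rewrite -[RHS](sm i (z * y^-1)%g).
  rewrite [RHS](reindex (fun w : P * C => ((w.1 * y^-1)%g, w.2))) /=.
    by apply: eq_bigl => w; rewrite (inj_eq (mulIg _)).
  by exists (fun w => ((w.1 * y)%g, w.2)) => -[x c1] _ /=; rewrite ?mulgK ?mulgVK.
move=> v; rewrite (frow_eta v); set m := fun i => _.
move=> /(gr_aug_kerP _ _ _ actPP) [km sm] fixm.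
pose m0 (a : D * C) := m (a.1, (1%g, a.2)).
have mE i x c : m (i, (x, c)) = m0 (i, c).
  have := fixm x (in_setT x); rewrite rhoE => /frow_inj /(_ (i, (x, c))) <- /=.
  by rewrite /sh /= mulgV.
have -> : frow m = frow m0 *m Pull.
  rewrite frow_mul; apply: eq_frow => -[i [x c]].
  rewrite mE (bigD1 (i, c)) //= eqxx mulr1 big1 ?addr0 // => a /negPf ->.
  by rewrite mulr0.
apply: submxMr; apply/(gr_aug_kerP _ _ _ actC); split=> [j w|i []].
  rewrite -[RHS](km j (1%g, w)); apply: eq_bigr => x _.
  by rewrite /= mE.
rewrite -[RHS](sm i 1%g) [RHS](reindex (fun c : C => (1%g : P, c))) /=.
  by apply: eq_big => c; rewrite ?eqxx // => _; rewrite mE.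
by exists snd => // -[x c] /=; rewrite inE /= => /eqP ->.
Qed.

End PGroupExtension.

(** * Crossed homomorphisms and relations *)

Section Words.
Import Order.TTheory GRing.Theory Num.Theory.
Local Open Scope group_scope.
Local Open Scope ring_scope.
Variables (G : groupType) (d : nat) (x : 'I_d -> G).

(** Words are positive: the family [x] will generate [G] as a monoid, and a relation is a pair of
    words. *)
Definition wprod (w : seq 'I_d) : G := foldr (fun i h => (x i * h)%g) 1%g w.

Lemma wprod_cat v w : wprod (v ++ w) = (wprod v * wprod w)%g.
Proof. by elim: v => [|i v IHv] /=; rewrite ?mul1g // IHv mulgA. Qed.

(* The value at [wprod w] of the crossed homomorphism taking the value [m i]
   at the generator [x i]. *)
Fixpoint fox (k : nmodType) (Om : Type) (act : G -> Om -> Om) (m : 'I_d * Om -> k)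
    (w : seq 'I_d) (om : Om) : k :=
  if w is i :: w' then m (i, om) + fox act m w' (act (x i)^-1%g om) else 0.

(** The Fox derivatives of [w] with respect to the generators, placed in column [e]: each letter
    contributes the prefix before it. *)
Fixpoint fox_terms (E : Type) (e : E) (w : seq 'I_d) : grmx G 'I_d E :=
  if w is i :: w' then
    (1, 1%g, (i, e)) :: [seq (y.1.1, (x i * y.1.2)%g, y.2) | y <- fox_terms e w']
  else [::].

Lemma fox_cat (k : nmodType) (Om : Type) (act : G -> Om -> Om) (m : 'I_d * Om -> k) v w om :
  is_act act ->
  fox act m (v ++ w) om = fox act m v om + fox act m w (act (wprod v)^-1%g om).
Proof.
move=> actP; elim: v om => [|i v IHv] om /=.
  by rewrite invg1 actP.1 add0r.
by rewrite IHv addrA invgM actP.2.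
Qed.

Lemma fox_termsE (k : nzRingType) (Om : Type) (E : eqType) (act : G -> Om -> Om)
    (m : 'I_d * Om -> k) (e j : E) w om : is_act act ->
  gr_apply act (fox_terms e w) m j om = if j == e then fox act m w om else 0.
Proof.
move=> actP; elim: w om => [|i w IHw] om; rewrite /gr_apply.
  by rewrite big_nil; case: ifP.
rewrite big_cons /= big_map /=.
have -> : \sum_(y <- fox_terms e w | y.2.2 == j)
    y.1.1%:~R * m (y.2.1, act (x i * y.1.2)^-1%g om) =
    gr_apply act (fox_terms e w) m j (act (x i)^-1%g om).
  by apply: eq_bigr => y _; rewrite invgM actP.2.
rewrite IHw [e == j]eq_sym; case: (j == e) => //.
by rewrite mul1r invg1 actP.1.
Qed.

Lemma gr_apply_cat (k : nzRingType) (Om D : Type) (E : eqType) (act : G -> Om -> Om)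
    (t t' : grmx G D E) (m : D * Om -> k) j om :
  gr_apply act (t ++ t') m j om = gr_apply act t m j om + gr_apply act t' m j om.
Proof. by rewrite /gr_apply big_cat. Qed.

Lemma gr_apply_opp (k : nzRingType) (Om D : Type) (E : eqType) (act : G -> Om -> Om)
    (t : grmx G D E) (m : D * Om -> k) j om :
  gr_apply act (gr_opp t) m j om = - gr_apply act t m j om.
Proof.
rewrite /gr_apply big_map /= -sumrN; apply: eq_bigr => y _.
by rewrite rmorphN mulNr.
Qed.

Lemma gr_apply_flatten (k : nzRingType) (Om D : Type) (E : eqType) (I : Type) (act : G -> Om -> Om)
    (s : seq I) (F : I -> grmx G D E) (m : D * Om -> k) j om :
  gr_apply act (flatten [seq F i | i <- s]) m j om = \sum_(i <- s) gr_apply act (F i) m j om.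
Proof.
elim: s => [|i s IHs] /=; first by rewrite big_nil /gr_apply big_nil.
by rewrite gr_apply_cat IHs big_cons.
Qed.

(** The Fox Jacobian of the relations [L]. *)
Definition relmx (L : seq (seq 'I_d * seq 'I_d)) : grmx G 'I_d 'I_(size L) :=
  flatten [seq (fox_terms e (tnth (in_tuple L) e).1 ++
                gr_opp (fox_terms e (tnth (in_tuple L) e).2)) | e <- enum 'I_(size L)].

Lemma relmx_kerP (k : nzRingType) (Om : Type) (act : G -> Om -> Om) (m : 'I_d * Om -> k) L :
  is_act act ->
  gr_ker act (relmx L) m <-> forall r, r \in L -> fox act m r.1 =1 fox act m r.2.
Proof.
move=> actP.
have relE j om : gr_apply act (relmx L) m j om =
    fox act m (tnth (in_tuple L) j).1 om - fox act m (tnth (in_tuple L) j).2 om.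
  rewrite gr_apply_flatten big_enum /= (bigD1 j) //= big1 => [|e ne].
    by rewrite addr0 gr_apply_cat gr_apply_opp !fox_termsE // eqxx.
  rewrite gr_apply_cat gr_apply_opp !fox_termsE // eq_sym (negPf ne).
  by rewrite subr0.
split=> [h r /(tnthP (in_tuple L)) [j ->] om | h j om].
  by apply/eqP; rewrite -subr_eq0 -relE h.
by rewrite relE h ?subrr // mem_tnth.
Qed.

(** Crossed homomorphisms to the functions on [Om], on which [g] acts by sending f to f composed
    with g^-1. *)
Definition cocycle (k : nmodType) (Om : Type) (act : G -> Om -> Om) (dl : G -> Om -> k) : Prop :=
  forall g h om, dl (g * h)%g om = dl g om + dl h (act g^-1%g om).

Lemma cocycle1 (k : zmodType) (Om : Type) (act : G -> Om -> Om) (dl : G -> Om -> k) om :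
  is_act act -> cocycle act dl -> dl 1%g om = 0.
Proof.
move=> actP /(_ 1%g 1%g om); rewrite mulg1 invg1 actP.1 => /eqP.
by rewrite -{1}[dl 1%g om]addr0 (inj_eq (addrI _)) eq_sym => /eqP.
Qed.

Lemma cocycle_fox (k : zmodType) (Om : Type) (act : G -> Om -> Om) (dl : G -> Om -> k) w om :
  is_act act -> cocycle act dl ->
  fox act (fun a => dl (x a.1) a.2) w om = dl (wprod w) om.
Proof.
move=> actP cdl; elim: w om => [|i w IHw] om /=; first by rewrite (cocycle1 _ actP).
by rewrite IHw -cdl.
Qed.

Hypothesis genx : forall g, exists w, wprod w = g.

Definition word_of (g : G) : seq 'I_d := projT1 (cid (genx g)).

Lemma wprod_word_of g : wprod (word_of g) = g.
Proof. exact: projT2 (cid (genx g)). Qed.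

Lemma fox_cocycle (k : nmodType) (Om : Type) (act : G -> Om -> Om) (m : 'I_d * Om -> k) :
    is_act act ->
    (forall v w, wprod v = wprod w -> fox act m v =1 fox act m w) ->
  cocycle act (fun g => fox act m (word_of g)).
Proof.
move=> actP h g g' om; rewrite -{3}(wprod_word_of g) -fox_cat //.
by apply: h; rewrite wprod_cat !wprod_word_of.
Qed.

(** Among finite lists of relations, take one whose kernel has least dimension: a further relation
    that fails on this kernel would cut it down. *)
Lemma finite_relations (k : fieldType) (Om : finType) (act : G -> Om -> Om) : is_act act ->
  exists2 L, (forall r, r \in L -> wprod r.1 = wprod r.2) &
    forall m : 'I_d * Om -> k, gr_ker act (relmx L) m ->
      forall v w, wprod v = wprod w -> fox act m v =1 fox act m w.
Proof.
move=> actP; pose nul L := nullity (gr_matrix k act (relmx L)).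
pose rels (L : seq (seq (ordinal d) * seq (ordinal d))) :=
  forall r, r \in L -> wprod r.1 = wprod r.2.
have [L relL minL] : exists2 L, rels L & forall L', rels L' -> (nul L <= nul L')%N.
  have exL : exists n, `[< exists2 L, rels L & nul L = n >].
    by exists (nul [::]); apply/asboolP; exists [::].
  have [n /asboolP[L relL <-] minn] := ex_minnP exL.
  by exists L => // L' relL'; apply: minn; apply/asboolP; exists L'.
exists L => // m km v w vw; apply: contrapT => nvw.
have relL' : rels ((v, w) :: L) by move=> r; rewrite inE => /predU1P[->|/relL].
have := minL _ relL'; rewrite leqNgt => /negP; apply; rewrite /nul !nullityE.
apply: rank_ltmx; rewrite /ltmx; apply/andP; split.
  apply: frow_subP => u /(gr_kerP _ _ actP) /(relmx_kerP _ _ actP) h.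
  by apply/(gr_kerP _ _ actP)/(relmx_kerP _ _ actP) => r rL; apply: h; rewrite inE rL orbT.
apply/negP => sub; apply: nvw.
have /(gr_kerP _ _ actP)/(relmx_kerP _ _ actP)/(_ (v, w)) :
    (frow m <= kermx (gr_matrix k act (relmx ((v, w) :: L))))%MS.
  by apply: submx_trans sub; apply/(gr_kerP _ _ actP).
by apply; rewrite inE eqxx.
Qed.

Lemma fox_sum0 (k : zmodType) (Om : finType) (act : G -> Om -> Om) (m : 'I_d * Om -> k) w :
  is_act act -> (forall i, \sum_om m (i, om) = 0) -> \sum_om fox act m w om = 0.
Proof.
move=> actP m0; elim: w => [|i w IHw] /=; first by rewrite big1.
rewrite big_split /= m0 add0r -[RHS]IHw [RHS](reindex (act (x i)^-1%g)) //=.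
by exists (act (x i)) => om _; rewrite ?(actK actP) ?(actVK actP).
Qed.

(** Sending [dl] to the sum of the [dl (r c)] is injective on the augmented kernel by the last
    hypothesis. Its values are sum-zero functions on [C], a proper subspace of the functions on
    [C]. *)
Lemma cocycle_nullity_bound (k : fieldType) (C : finType) (act : G -> C -> C) (r : C -> G) L :
    is_act act -> (0 < #|C|)%N ->
    (forall m : 'I_d * C -> k, gr_ker act (relmx L) m ->
      forall v w, wprod v = wprod w -> fox act m v =1 fox act m w) ->
    (forall dl : G -> C -> k, cocycle act dl -> (forall g, \sum_c dl g c = 0) ->
       (forall c', \sum_c dl (r c) c' = 0) -> forall g c, dl g c = 0) ->
  (nullity (gr_aug_matrix k act (fun=> tt) (relmx L)) < #|C|)%N.
Proof.
move=> actP C0 relL no_dl.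
pose Ev : 'M[k]_(#|{: 'I_d * C}|, #|{: unit * C}|) :=
  gr_matrix k act (flatten [seq fox_terms tt (word_of (r c)) | c <- enum C]).
have EvE m : frow m *m Ev = frow (fun b => \sum_c fox act m (word_of (r c)) b.2).
  rewrite /Ev /gr_matrix map_fmx frow_mul; apply: eq_frow => -[[] c'].
  rewrite gr_evE // gr_apply_flatten big_enum /=; apply: eq_bigr => c _.
  by rewrite fox_termsE ?eqxx.
set K := kermx (gr_aug_matrix k act (fun=> tt) (relmx L)).
have Kcap : (K :&: kermx Ev)%MS = 0.
  apply/eqP; rewrite -submx0; apply: frow_subP => m; rewrite sub_capmx.
  case/andP=> /(gr_aug_kerP _ _ _ actP) [km sm] /sub_kermxP; rewrite EvE => ev0.
  have co := fox_cocycle actP (relL _ km).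
  have m0 a : m a = 0.
    case: a => i c; transitivity (fox act m (word_of (x i)) c).
      rewrite (relL _ km _ [:: i]) /= ?addr0 //.
      by rewrite wprod_word_of mulg1.
    apply: (no_dl _ co).
      move=> g; apply: fox_sum0 => // j.
      by rewrite -[RHS](sm j tt); apply: eq_bigl => om; rewrite eqxx.
    by move=> c'; exact: (frow0P ev0 (tt, c')).
  by rewrite (_ : frow m = 0) ?sub0mx //; apply/rowP => b; rewrite !mxE m0.
rewrite nullityE -/K -(mxrank_mul_ker K Ev) Kcap mxrank0 addn0.
pose one : 'cV[k]_#|{: unit * C}| := const_mx 1.
have : (\rank (K *m Ev) <= nullity one)%N.
  rewrite nullityE; apply: mxrankS; apply/rV_subP => v /submxP[c ->]; rewrite mulmxA.
  have : (c *m K <= K)%MS by apply: submxMl.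
  move: (c *m _) => u; rewrite (frow_eta u) EvE; set m := fun i => _.
  move/(gr_aug_kerP _ _ _ actP) => [km sm]; apply/sub_kermxP/rowP => z.
  rewrite !mxE.
  under eq_bigr do rewrite !mxE mulr1.
  rewrite (sum_enum_val (fun b : unit * C => \sum_c fox act m (word_of (r c)) b.2)).
  rewrite exchange_big /= big1 // => c0 _.
  rewrite -[RHS](fox_sum0 (m := m) (word_of (r c0)) actP).
    rewrite [RHS](reindex (fun b : unit * C => b.2)) //.
    by exists (fun c1 => (tt, c1)) => // -[[] ?].
  by move=> j; rewrite -[RHS](sm j tt); apply: eq_bigl => om; rewrite eqxx.
move/leq_ltn_trans; apply.
have card1 : #|{: unit * C}| = #|C| by rewrite card_prod card_unit mul1n.
rewrite /nullity.
have one0 : one != 0.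
  have c : 'I_#|{: unit * C}| by rewrite card1; exact: Ordinal C0.
  by apply/eqP => /matrixP/(_ c 0); rewrite !mxE => /eqP; rewrite oner_eq0.
move: one0; rewrite -mxrank_eq0 -lt0n => r0.
by rewrite -[X in (_ < X)%N]card1 ltn_subrL r0 card1.
Qed.

End Words.

(** * Free groups *)

Section FreeInduction.
Local Open Scope group_scope.

HB.instance Definition _ (G : groupType) (S : {pred G}) :=
  isMulClosed.Build G (gen S) (group_closedM (gen_group_closed S)).
HB.instance Definition _ (G : groupType) (S : {pred G}) :=
  isMul1Closed.Build G (gen S) (proj1 (gen_group_closed S)).
HB.instance Definition _ (G : groupType) (S : {pred G}) :=
  isInvClosed.Build G (gen S) (group_closedV (gen_group_closed S)).

Definition is_basis_of (F : groupType) (X : Type) (e : X -> F) : Prop :=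
  forall (H : groupType) (f : X -> H),
    exists2 h : groupHom F H, (forall x, h (e x) = f x) &
      forall h' : groupHom F H, (forall x, h' (e x) = f x) -> h' =1 h.

(** The elements [x] such that left multiplication by [x] and by its inverse both preserve [Q] form
    a subgroup. *)
Lemma gen_ind (G : groupType) (S : {pred G}) (Q : G -> Prop) :
  Q 1 -> (forall x g, x \in S -> Q g -> Q (x * g)) ->
  (forall x g, x \in S -> Q g -> Q (x^-1 * g)) -> forall g, g \in gen S -> Q g.
Proof.
move=> Q1 QM QV g /asboolP gS.
pose H : {pred G} := fun x => `[< forall h, Q h -> Q (x * h) /\ Q (x^-1 * h) >].
have /asboolP/(_ 1 Q1) [] : g \in H; last by rewrite mulg1.
apply: gS => [|x xS]; last by apply/asboolP => h Qh; split; [exact: QM | exact: QV].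
split=> [|x y /asboolP xH /asboolP yH]; apply/asboolP => h Qh.
  by rewrite invg1 !mul1g.
rewrite invgF -!mulgA; split; first by apply: (xH _ _).1; apply: (yH _ Qh).2.
by apply: (yH _ _).1; apply: (xH _ Qh).2.
Qed.

(** The universal property gives a map from [F] to the subgroup generated by the basis; followed by
    the inclusion it is the identity, by uniqueness. *)
Lemma basis_gen (F : groupType) (X : Type) (e : X -> F) : is_basis_of e ->
  forall g, g \in gen (fun y => `[< exists x, y = e x >]).
Proof.
move=> eP g; set S : {pred F} := fun y => _.
have eS x : e x \in gen S by apply: Defs.mem_gen; apply/asboolP; exists x.
pose U : groupClosed F := gen S.
have [h he _] := eP (subgroup U) (fun x => exist _ (e x) (eS x)).
have [h0 _ uniq] := eP F e.
pose vh : groupHom F F := (val : subgroup U -> F) \o h.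
have -> : g = val (h g).
  transitivity (h0 g); first exact: (uniq idfun).
  by symmetry; apply: (uniq vh) => x /=; rewrite he.
exact: valP.
Qed.

Lemma basis_ind (F : groupType) (X : Type) (e : X -> F) (Q : F -> Prop) : is_basis_of e ->
  Q 1 -> (forall x g, Q g -> Q (e x * g)) ->
  (forall x g, Q g -> Q ((e x)^-1 * g)) -> forall g, Q g.
Proof.
move=> eP Q1 QM QV g; apply: gen_ind (basis_gen eP g) => // [y h|y h] /asboolP[x ->].
  exact: QM.
exact: QV.
Qed.

(* A syllable [(x, (m, n))] stands for [e x ^+ m * e x ^- n]. *)
Definition syllables (F : groupType) (X : Type) (e : X -> F) (s : seq (X * (nat * nat))) : F :=
  foldr (fun y g => e y.1 ^+ y.2.1 * (e y.1 ^- y.2.2) * g) 1 s.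

Lemma syllables_ex (F : groupType) (X : Type) (e : X -> F) : is_basis_of e ->
  forall g, exists s, syllables e s = g.
Proof.
move=> eP; apply: (basis_ind eP) => [|x g [s <-]|x g [s <-]]; first by exists [::].
  by exists ((x, (1%N, 0%N)) :: s) => /=; rewrite expg1 expg0 invg1 mulg1.
by exists ((x, (0%N, 1%N)) :: s) => /=; rewrite expg1 expg0 mul1g.
Qed.

Lemma syllables_cat (F : groupType) (X : Type) (e : X -> F) s t :
  syllables e (s ++ t) = syllables e s * syllables e t.
Proof. by elim: s => [|y s IHs] /=; rewrite ?mul1g // IHs !mulgA. Qed.

(** In an expression with the fewest syllables, none can be deleted and no two neighbours can be
    merged. *)
Lemma reduced_syllables (F : groupType) (X : Type) (e : X -> F) (x0 : X) : is_basis_of e ->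
  forall g, exists s, [/\ syllables e s = g,
    forall i, (i < size s)%N -> (nth (x0, (0, 0)) s i).2.1 <> (nth (x0, (0, 0)) s i).2.2 :> nat &
    forall i, (i.+1 < size s)%N -> (nth (x0, (0, 0)) s i).1 <> (nth (x0, (0, 0)) s i.+1).1 ].
Proof.
move=> eP g; set y0 := (x0, _).
have exn : exists n, `[< exists2 s, syllables e s = g & size s = n >].
  by have [s sg] := syllables_ex eP g; exists (size s); apply/asboolP; exists s.
have [n /asboolP[s sg sn] minn] := ex_minnP exn.
have min t : syllables e t = g -> (size s <= size t)%N.
  by move=> tg; rewrite sn; apply: minn; apply/asboolP; exists t.
exists s; split=> // i ltis.
  move=> eq; have := min (take i s ++ drop i.+1 s).
  rewrite size_cat size_take size_drop ltis syllables_cat => h.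
  suff : (size s <= i + (size s - i.+1))%N by lia.
  apply: h; rewrite -[RHS]sg -[in RHS](cat_take_drop i s) (drop_nth y0 ltis) syllables_cat /=.
  by rewrite eq mulgV mul1g.
move=> eq; have lti := ltnW ltis.
pose a := nth y0 s i; pose b := nth y0 s i.+1.
have := min (take i s ++ (a.1, (a.2.1 + b.2.1, a.2.2 + b.2.2)%N) :: drop i.+2 s).
rewrite size_cat /= size_take size_drop lti syllables_cat /= => h.
suff : (size s <= i + (size s - i.+2).+1)%N by lia.
apply: h; rewrite -[RHS]sg -[in RHS](cat_take_drop i s) (drop_nth y0 lti) (drop_nth y0 ltis).
rewrite syllables_cat /= -/a -/b -[in RHS]eq -/a; congr (_ * _).
rewrite !mulgA; congr (_ * _).
rewrite expgnDr -!mulgA; congr (_ * _).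
rewrite -!expVgn expgnDr !mulgA; congr (_ * _).
by apply: commuteX2; apply: commuteV.
Qed.

End FreeInduction.

(** * Separating elements of free groups in finite q-groups *)

Section ResiduallyP.
Import Order.TTheory GRing.Theory Num.Theory.
Local Open Scope group_scope.
Local Open Scope ring_scope.

Section Unitriangular.
Variables (R : finFieldType) (n : nat).
Local Notation M := 'M[R]_n.+1.

Definition unitriangular (A : M) :=
  [forall i : 'I_n.+1, forall j : 'I_n.+1, (j <= i)%N ==> (A i j == (i == j)%:R)].

Lemma unitriangularP (A : M) :
  reflect (forall i j : 'I_n.+1, (j <= i)%N -> A i j = (i == j)%:R) (unitriangular A).
Proof.
apply: (iffP forallP) => [h i j ji | h i].
  by apply/eqP; move/forallP/(_ j)/implyP: (h i); apply.
by apply/forallP => j; apply/implyP => ji; apply/eqP; exact: h.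
Qed.

Lemma unitriangular_unit A : unitriangular A -> A \in unitmx.
Proof.
move=> /unitriangularP uA; rewrite -unitmx_tr unitmxE det_trig.
  by rewrite big1 ?unitr1 // => i _; rewrite mxE uA // eqxx.
apply/is_trig_mxP => i j ij; rewrite mxE uA ?(ltnW ij) //.
by rewrite -val_eqE /= gtn_eqF.
Qed.

Lemma strictly_upper_exp (N : M) k : (forall i j : 'I_n.+1, (j <= i)%N -> N i j = 0) ->
  forall i j : 'I_n.+1, (j < i + k)%N -> (N ^+ k) i j = 0.
Proof.
move=> N0; elim: k => [|k IHk] i j ji.
  by rewrite expr0 mxE -val_eqE gtn_eqF // -[X in (_ < X)%N]addn0.
rewrite exprS mxE big1 // => l _.
have [li|il] := leqP l i; first by rewrite N0 // mul0r.
by rewrite IHk ?mulr0 //; lia.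
Qed.

Definition unitri_set : {set {'GL_n.+1[R]}} := [set u | unitriangular (val u)].

Lemma unitriangularM A B : unitriangular A -> unitriangular B -> unitriangular (A *m B).
Proof.
move=> /unitriangularP uu /unitriangularP uv; apply/unitriangularP => i j ji.
rewrite mxE (bigD1 i) //= uu // eqxx mul1r uv // big1 ?addr0 // => k ki.
have [le_ki|lt_ik] := leqP k i; first by rewrite uu // eq_sym (negPf ki) mul0r.
have jk : (j < k)%N by lia.
by rewrite uv ?(ltnW jk) // -val_eqE (gtn_eqF jk) mulr0.
Qed.

Lemma unitri_group_set : group_set unitri_set.
Proof.
apply/group_setP; split=> [|u v].
  by rewrite in_set; apply/unitriangularP => i j _; rewrite mxE.
by rewrite !in_set; exact: unitriangularM.
Qed.

Definition unitri_group := group unitri_group_set.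

Definition unitri_type : finGroupType := subg_of unitri_group.

Definition unitri_val (u : unitri_type) : M := val (sgval u).

Lemma unitri_val1 : unitri_val 1%g = 1. Proof. by []. Qed.

Lemma unitri_valM u v : unitri_val (u * v)%g = unitri_val u * unitri_val v.
Proof. by []. Qed.

Lemma unitri_valX u k : unitri_val (u ^+ k)%g = unitri_val u ^+ k.
Proof. by elim: k => [|k IHk] //; rewrite exprS expgS unitri_valM IHk. Qed.

Lemma unitri_val_inj : injective unitri_val.
Proof. by move=> u v /val_inj /val_inj. Qed.

Lemma unitri_valP u : unitriangular (unitri_val u).
Proof. by have := valP u; rewrite inE. Qed.

Lemma unitri_ex A : unitriangular A -> exists u : unitri_type, unitri_val u = A.
Proof.
move=> uA; pose g : {'GL_n.+1[R]} := FinRing.unit _ (unitriangular_unit uA).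
have gU : g \in unitri_group by rewrite inE.
by exists (subg unitri_group g); rewrite /unitri_val subgK.
Qed.

Variable q : nat.
Hypotheses (q_pr : prime q) (qR : q \in [pchar R]).

(** By Frobenius, A^(q^k) - 1 = (A - 1)^(q^k), and [q ^ n.+1] exceeds the size [n.+1] of the
    strictly triangular matrix A - 1. *)
Lemma unitriangular_exp A : unitriangular A -> A ^+ (q ^ n.+1) = 1.
Proof.
move=> /unitriangularP uA; pose N := A - 1.
have frob k (B : M) : (B - 1%:M) ^+ (q ^ k) = B ^+ (q ^ k) - 1%:M.
  elim: k => [|k IHk]; first by rewrite !expr1.
  by rewrite expnSr exprM IHk (expr_sub1_pchar _ qR) -exprM.
have N0 : N ^+ (q ^ n.+1) = 0.
  apply/matrixP => i j; rewrite [RHS]mxE; apply: strictly_upper_exp.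
    by move=> k l lk; rewrite !mxE uA ?subrr.
  by have := ltn_expl n.+1 (prime_gt1 q_pr); have := ltn_ord j; lia.
by apply/eqP; rewrite -subr_eq0 -[1]/(1%:M) -frob; apply/eqP.
Qed.

Lemma unitri_pgroup : (q.-group [set: unitri_type])%g.
Proof.
apply/pgroupP => r r_pr rdiv.
have [u _ ou] := Cauchy r_pr rdiv.
have : (r %| q ^ n.+1)%N.
  rewrite -ou order_dvdn; apply/eqP/unitri_val_inj.
  by rewrite unitri_valX (unitriangular_exp (unitri_valP u)).
by rewrite Euclid_dvdX // => /andP[]; rewrite dvdn_prime2 // => /eqP ->; rewrite inE.
Qed.

End Unitriangular.

(* Magnus: write [w] with a minimal number [n] of syllables and send the basis
   element [x] to [1 + Nx x], where [Nx x] is the sum of the elementary matrices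
   [E_(i, i+1)] over the positions [i] of the syllables in [x]. Adjacent syllables
   differ, so [Nx x ^+ 2 = 0], and the upper right entry of the image of [w] is the
   product of the exponents, which is nonzero modulo a large prime. *)
Lemma free_residually_p_elt (F : groupType) (w : F) : is_free_group F -> w != 1%g ->
  exists N : nat, forall q, prime q -> (N < q)%N ->
    exists (P : finGroupType) (phi : groupHom F P),
      (q.-group [set: P])%g /\ phi w != 1%g.
Proof.
move=> [X [e eP]] w1.
have [x0 _] : exists x0 : X, True.
  apply: contrapT => noX; move/eqP: w1; apply.
  by apply: (basis_ind eP (Q := fun g => g = 1%g)) => // x; case: noX; exists x.
have [s [sw nz red]] := reduced_syllables x0 eP w.
set y0 := (x0, (0, 0)%N) in nz red.
have s0 : (0 < size s)%N.
  by case: (s) sw => //= sw; rewrite -sw eqxx in w1.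
(* Beyond this bound the two distinct exponents of a syllable stay distinct modulo [q]. *)
exists (\sum_(y <- s) (y.2.1 + y.2.2))%N => q q_pr ltq.
set n := size s.
pose lab i := (nth y0 s i).1.
pose Nx x : 'M['F_q]_n.+1 :=
  \matrix_(i, j) ((j == i.+1 :> nat) && (i < n)%N && `[< lab i = x >])%:R.
have Nx0 x : Nx x * Nx x = 0.
  apply/matrixP => i j; rewrite !mxE big1 // => k _; rewrite !mxE.
  case: andP => [[/andP[/eqP ki _] /asboolP ix]|]; last by rewrite mul0r.
  case: andP => [[/andP[_ kn] /asboolP kx]|]; last by rewrite mulr0.
  by case: (red i); rewrite -/(lab i) -?ki -?/(lab k) ?ix ?kx.
have unit1 x c : unitriangular (1 + c *: Nx x).
  apply/unitriangularP => i j ji; rewrite !mxE.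
  rewrite [_ == i.+1](_ : _ = false) ?mulr0 ?addr0 //.
  by apply/eqP => ji'; move: ji; rewrite ji' ltnn.
pose u x : @unitri_type 'F_q n := projT1 (cid (unitri_ex (unit1 x 1))).
have uE x : unitri_val (u x) = 1 + Nx x.
  by rewrite /u; case: cid => /= a ->; rewrite scale1r.
have [phi phie _] := eP (@unitri_type 'F_q n) u.
exists (@unitri_type 'F_q n), phi; split; first exact: (unitri_pgroup _ q_pr (pchar_Fp q_pr)).
have uX x k : unitri_val (u x ^+ k)%g = 1 + k%:R *: Nx x.
  rewrite unitri_valX uE; elim: k => [|k IHk]; first by rewrite expr0 scale0r addr0.
  rewrite exprS IHk mulrDl mul1r mulrDr mulr1 -scalerAr Nx0 scaler0 addr0.
  by rewrite -natr1 scalerDl scale1r addrA.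
have uV x k : unitri_val (u x ^- k)%g = 1 - k%:R *: Nx x.
  have e1 : unitri_val (u x ^- k)%g * unitri_val (u x ^+ k)%g = 1.
    by rewrite -unitri_valM mulVg.
  have e2 : unitri_val (u x ^+ k)%g * (1 - k%:R *: Nx x) = 1.
    rewrite uX mulrDl mul1r mulrBr mulr1 -scalerAl -scalerAr Nx0 !scaler0 subr0.
    by rewrite subrK.
  by rewrite -[LHS]mulr1 -[X in _ * X = _]e2 mulrA e1 mul1r.
pose cf i : 'F_q := (nth y0 s i).2.1%:R - (nth y0 s i).2.2%:R.
have cf0 i : (i < n)%N -> cf i != 0.
  move=> lti; have := nz _ lti.
  have : ((nth y0 s i).2.1 + (nth y0 s i).2.2 < q)%N.
    apply: leq_ltn_trans ltq; rewrite (big_nth y0) big_mkord (bigD1 (Ordinal lti)) //=.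
    exact: leq_addr.
  rewrite /cf; move: (nth y0 s i).2 => [a b] /= abq neq.
  rewrite subr_eq0; apply/negP => /eqP /(congr1 val).
  rewrite /= !val_Fp_nat // !modn_small //; lia.
(* Downward induction on [k]: in the last column of the image of the suffix from syllable [k] on,
   the entries above row [k] vanish. The case [k = 0] is the upper right entry. *)
have dropE k : (k <= n)%N -> forall i : 'I_n.+1, (i <= k)%N ->
    unitri_val (phi (syllables e (drop k s))) i ord_max =
    if i == k :> nat then \prod_(k <= j < n) cf j else 0.
  move=> kn; rewrite -(subKn kn); move: (n - k)%N (leq_subr k n) => {k kn} l.
  elim: l => [|l IHl] ln i ik.
    rewrite subn0 in ik *; rewrite drop_size /= gmulf1 unitri_val1 mxE big_geq //.
    by rewrite -val_eqE /=; case: eqP.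
  have ltk : (n - l.+1 < n)%N by lia.
  have eS : (n - l.+1).+1 = (n - l)%N by lia.
  rewrite (drop_nth y0 ltk) /= !gmulfM gmulfXn gmulfXVn !phie !unitri_valM uX uV.
  rewrite -[X in X * _]/((1 + _) * (1 - _)) mulrDl mul1r mulrBr mulr1.
  rewrite -scalerAl -scalerAr Nx0 !scaler0 subr0.
  rewrite addrAC -addrA -scalerBl -/(cf _) -/(lab _) eS.
  set B := unitri_val (phi _).
  have BE (j : 'I_n.+1) : (j <= n - l)%N ->
      B j ord_max = if j == (n - l)%N :> nat then \prod_(n - l <= k < n) cf k else 0.
    by move=> jl; apply: IHl => //; lia.
  rewrite mulrDl mul1r mxE BE; last by lia.
  rewrite [_ == (n - l)%N](_ : _ = false) ?add0r; last by apply/eqP; lia.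
  rewrite -scalerAl mxE mxE.
  have i1 : (i.+1 < n.+1)%N by lia.
  rewrite (bigD1 (Ordinal i1)) //= big1 ?addr0 => [|j ji]; last first.
    by rewrite mxE [_ == i.+1](_ : _ = false) ?mul0r //; move: ji; rewrite -val_eqE /= => /negPf.
  rewrite mxE /= eqxx /= [(i < n)%N](_ : _ = true) /=; last by lia.
  rewrite BE /=; last by lia.
  case: (eqVneq (i : nat) (n - l.+1)%N) => [ei|ne].
    rewrite ei eS eqxx [`[< _ >]](_ : _ = true) ?mul1r; last exact/asboolP.
    by rewrite [RHS]big_ltn // eS.
  rewrite [_ == (n - l)%N](_ : _ = false) ?mulr0 //.
  by apply/eqP; move/eqP: ne; lia.
apply/eqP => phi1; have := dropE 0 (leq0n n) ord0 (leqnn 0).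
rewrite drop0 sw phi1 unitri_val1 mxE /= => /eqP.
rewrite [_ == ord_max](_ : _ = false) ?mulr0n; last by rewrite -val_eqE /= ltn_eqF.
rewrite eq_sym prodf_seq_eq0 => /hasP[j]; rewrite mem_index_iota => /andP[_ jn] /= /eqP cj.
by move: (cf0 _ jn); rewrite cj eqxx.
Qed.

End ResiduallyP.

(** Each element is separated for all large [q], so one prime serves the whole list and the product
    of the q-groups separates all its members. *)
Lemma free_residually_p (F : groupType) (s : seq F) : is_free_group F ->
  exists N : nat, forall q, prime q -> (N < q)%N ->
    exists (P : finGroupType) (phi : F -> P),
      [/\ (q.-group [set: P])%g, {morph phi : x y / (x * y)%g} &
          forall w, w \in s -> w != 1%g -> phi w != 1%g].
Proof.
move=> freeF; elim: s => [|w s [N1 IHs]].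
  exists 0 => q q_pr _; exists (@unitri_type 'F_q 0), (fun=> 1%g); split=> //.
    exact: (unitri_pgroup _ q_pr (pchar_Fp q_pr)).
  by move=> x y; rewrite mulg1.
have [N2 resw] : exists N2, w != 1%g -> forall q, prime q -> (N2 < q)%N ->
    exists (P : finGroupType) (phi : groupHom F P), (q.-group [set: P])%g /\ phi w != 1%g.
  have [->|w1] := eqVneq w 1%g; first by exists 0.
  by have [N2] := free_residually_p_elt freeF w1; exists N2.
exists (maxn N1 N2) => q q_pr; rewrite gtn_max => /andP[q1 q2].
have [P1 [phi1 [qP1 phi1M h1]]] := IHs q q_pr q1.
have [w1|w1] := eqVneq w 1%g.
  exists P1, phi1; split=> // v; rewrite inE => /predU1P[->|]; last exact: h1.
  by rewrite w1 eqxx.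
have [P2 [phi2 [qP2 h2]]] := resw w1 q q_pr q2.
exists (P1 * P2)%type, (fun g => (phi1 g, phi2 g)); split.
- rewrite /pgroup cardsT card_prod pnatM -!cardsT.
  by apply/andP; split; [exact: qP1 | exact: qP2].
- by move=> x y /=; rewrite phi1M gmulfM.
move=> v; rewrite inE => /predU1P[->|vs] v1.
  by apply: contraNneq h2 => -[_ ->].
by apply: contraNneq (h1 _ vs v1) => -[-> _].
Qed.

Section Semidirect.
Import GRing.Theory.
Local Open Scope ring_scope.
Variables (A : zmodType) (P : finGroupType) (Om : finType) (act : P -> Om -> Om).
Hypothesis actP : is_act act.

(** A homomorphism to this group is a homomorphism to [P] together with a crossed homomorphism to
    the functions on [Om]; the universal property of a free group thus prescribes crossed
    homomorphisms on a basis. The argument ties the group structure to the action. *)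
Definition semidirect (_ : is_act act) : Type := ({ffun Om -> A} * P)%type.
Local Notation S := (semidirect actP).

HB.instance Definition _ := Choice.on S.

Definition semi_mul (u v : S) : S :=
  ([ffun w => u.1 w + v.1 (act u.2^-1%g w)], (u.2 * v.2)%g).
Definition semi_one : S := (0, 1%g).
Definition semi_inv (u : S) : S := ([ffun w => - u.1 (act u.2 w)], u.2^-1%g).

Fact semi_mulA : associative semi_mul.
Proof.
move=> u v w; rewrite /semi_mul /= mulgA; congr (_, _); apply/ffunP => z.
by rewrite !ffunE addrA invgM actP.2.
Qed.

Fact semi_mul1 : left_id semi_one semi_mul.
Proof.
case=> u g; rewrite /semi_mul /= mul1g; congr (_, _); apply/ffunP => z.
by rewrite !ffunE add0r invg1 actP.1.
Qed.

Fact semi_mulV : left_inverse semi_one semi_inv semi_mul.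
Proof.
case=> u g; rewrite /semi_mul /= mulVg; congr (_, _); apply/ffunP => z.
by rewrite !ffunE invgK addNr.
Qed.

Fact semi_mulg1 : right_id semi_one semi_mul.
Proof.
case=> u g; rewrite /semi_mul /= mulg1; congr (_, _); apply/ffunP => z.
by rewrite !ffunE addr0.
Qed.

Fact semi_mulgV : right_inverse semi_one semi_inv semi_mul.
Proof.
case=> u g; rewrite /semi_mul /= mulgV; congr (_, _); apply/ffunP => z.
by rewrite !ffunE -actP.2 mulgV actP.1 subrr.
Qed.

HB.instance Definition _ :=
  isGroup.Build S semi_mulA semi_mul1 semi_mulg1 semi_mulV semi_mulgV.

Lemma semi_mulE (u v : S) w : (u * v)%g.1 w = u.1 w + v.1 (act u.2^-1%g w).
Proof. by rewrite /= ffunE. Qed.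

Lemma semi_mul2 (u v : S) : (u * v)%g.2 = (u.2 * v.2)%g. Proof. by []. Qed.

Lemma semi_invE (u : S) w : (u^-1)%g.1 w = - u.1 (act u.2 w).
Proof. by rewrite /= ffunE. Qed.

Lemma semi_inv2 (u : S) : (u^-1)%g.2 = (u.2^-1)%g. Proof. by []. Qed.

End Semidirect.

(** * Integral lifts of homomorphisms defined on subgroups of free groups *)

Section CocycleLift.
Import GRing.Theory.
Local Open Scope group_scope.
Local Open Scope ring_scope.

Lemma lcoset_actP (P : finGroupType) : is_act (fun (g : P) (A : {set P}) => (g *: A)%g).
Proof. by split=> [A|g h A]; rewrite ?lcoset1 ?lcosetM. Qed.

Lemma mul_actT (P : finGroupType) : is_act (mul_act (@id P)).
Proof. exact: mul_actP. Qed.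

Section AdditiveOn.
Variables (V : zmodType) (P : finGroupType) (H : {group P}) (al : P -> V).
Hypothesis alM : {in H &, forall x y, al (x * y)%g = al x + al y}.

Lemma additive_on1 : al 1%g = 0.
Proof.
have := alM (group1 H) (group1 H); rewrite mulg1 => /eqP.
by rewrite -{1}[al _]addr0 (inj_eq (addrI _)) eq_sym => /eqP.
Qed.

Lemma additive_onV x : x \in H -> al x^-1%g = - al x.
Proof.
move=> xH; apply/eqP; rewrite -addr_eq0 -alM ?groupV // mulVg.
by rewrite additive_on1.
Qed.

Definition coset_rep (A : {set P}) : P := odflt 1%g [pick y | (y *: H)%g == A].

(* The restriction of the crossed homomorphism [coset_cocycle] to [H] and to
   the point [H] of [P / H] is [al]: this is coinduction from [H] to [P]. *)
Definition coset_cocycle (x : P) (A : {set P}) : V :=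
  al ((coset_rep A)^-1 * x * coset_rep (x^-1 *: A)%g)%g.

(** [P] acts on all of [{set P}]; this is the invariant part [P / H]. *)
Definition is_coset (A : {set P}) : Prop := exists y, A = (y *: H)%g.

Lemma is_coset_act x A : is_coset A -> is_coset (x *: A)%g.
Proof. by case=> y ->; exists (x * y)%g; rewrite lcosetM. Qed.

Lemma coset_repP A : is_coset A -> (coset_rep A *: H)%g = A.
Proof.
case=> y ->; rewrite /coset_rep; case: pickP => [z /eqP //|/(_ y)].
by rewrite eqxx.
Qed.

Lemma lcoset_fix y : (y *: H)%g = H :> {set P} -> y \in H.
Proof. by move=> yH; rewrite -[H : {set P}]yH lcoset_refl. Qed.

Lemma coset_cocycle_mem x A : is_coset A ->
  ((coset_rep A)^-1 * x * coset_rep (x^-1 *: A)%g)%g \in H.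
Proof.
move=> cA; apply: lcoset_fix; rewrite lcosetM coset_repP; last exact: is_coset_act.
by rewrite -lcosetM mulgK -{2}(coset_repP cA) -lcosetM mulVg lcoset1.
Qed.

Lemma coset_cocycleM x y A : is_coset A ->
  coset_cocycle (x * y)%g A = coset_cocycle x A + coset_cocycle y (x^-1 *: A)%g.
Proof.
move=> cA; have cA' := is_coset_act x^-1%g cA.
rewrite /coset_cocycle -alM; try exact: coset_cocycle_mem.
by rewrite invMg lcosetM !mulgA mulgK.
Qed.

Lemma coset_cocycleV x A : is_coset A ->
  coset_cocycle x^-1%g A = - coset_cocycle x (x *: A)%g.
Proof.
move=> cA; apply/eqP; rewrite -addr_eq0.
have := coset_cocycleM x^-1%g x cA; rewrite invgK => <-.
rewrite mulVg /coset_cocycle mulg1 invg1 lcoset1 mulVg.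
by rewrite additive_on1.
Qed.

Lemma coset_cocycle_base x : x \in H -> coset_cocycle x H = al x.
Proof.
move=> xH; rewrite /coset_cocycle.
have -> : (x^-1 *: H)%g = H by apply: lcoset_id; rewrite groupV.
have sH : coset_rep H \in H by apply: lcoset_fix; apply: coset_repP; exists 1%g; rewrite lcoset1.
by rewrite !alM ?groupM ?groupV // additive_onV // addrAC addNr add0r.
Qed.

End AdditiveOn.

(** Coinduction extends [al] from [H] to a crossed homomorphism on all of [P], whose values on the
    basis of [F] are lifted to integers. Freeness extends the lift to [F], and the component at the
    coset [H], which [H] fixes, gives [dl]. *)
Lemma cocycle_lift (F : groupType) (P : finGroupType) (phi : F -> P) q
    (H : {group P}) (al : P -> 'F_q) :
    is_free_group F -> {morph phi : x y / (x * y)%g} ->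
    {in H &, forall x y, al (x * y)%g = al x + al y} ->
  exists dl : F -> P -> int,
    (forall g h z, phi g \in H -> dl (g * h)%g z = dl g z + dl h ((phi g)^-1 * z)%g) /\
    (forall g, phi g \in H -> (\sum_z dl g z)%:~R = al (phi g)).
Proof.
move=> [X [e eP]] phiM alM.
have phi1 : phi 1%g = 1%g by apply: (mulgI (phi 1%g)); rewrite -phiM !mulg1.
have phiV x : phi x^-1%g = (phi x)^-1%g.
  by apply: (mulgI (phi x)); rewrite -phiM !mulgV.
pose actO := prod_actP (@lcoset_actP P) (@mul_actT P).
pose c := coset_cocycle H al.
pose u (x : X) : semidirect int actO :=
  (* The lifted residue is concentrated at the identity of the second factor [P], so that its sum
     over [P] reduces to the residue. *)
  ([ffun w => (nat_of_ord (c (phi (e x)) w.1))%:Z *+ (w.2 == 1%g)], phi (e x)).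
have [h he _] := eP (semidirect int actO : groupType) u.
have sum_u x A : (\sum_z (u x).1 (A, z))%:~R = c (phi (e x)) A.
  rewrite (bigD1 1%g) //= big1 => [|z /negPf nz]; last by rewrite ffunE /= nz.
  by rewrite ffunE eqxx addr0 mulr1n -pmulrn natr_Zp.
have sum_shift (f : {ffun {set P} * P -> int}) A (y : P) :
    \sum_z f (A, (y * z)%g) = \sum_z f (A, z).
  rewrite [RHS](reindex (mulg y)) //=.
  by exists (mulg y^-1%g) => z _; rewrite ?mulKg ?mulKVg.
have inv g : (h g).2 = phi g /\
    forall A, is_coset H A -> (\sum_z (h g).1 (A, z))%:~R = c (phi g) A.
  move: g; apply: (basis_ind eP) => [|x g [IH2 IH1]|x g [IH2 IH1]].
  - rewrite gmulf1 phi1; split=> // A cA; rewrite big1 => [|z _]; last by rewrite ffunE.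
    have := coset_cocycleM alM 1%g 1%g cA; rewrite mulg1 invg1 lcoset1 -/c => /eqP.
    by rewrite -{1}[c 1%g A]addr0 (inj_eq (addrI _)) eq_sym => /eqP ->.
  - rewrite gmulfM phiM semi_mul2 he IH2; split=> // A cA.
    under eq_bigr do rewrite semi_mulE.
    rewrite big_split rmorphD /= sum_u /c coset_cocycleM // -/c; congr (_ + _).
    rewrite -IH1; last exact: is_coset_act.
    congr (_%:~R); exact: (sum_shift (h g).1 ((phi (e x))^-1 *: A)%g (phi (e x))^-1%g).
  rewrite gmulfM gmulfV phiM phiV semi_mul2 semi_inv2 he IH2; split=> // A cA.
  under eq_bigr do rewrite semi_mulE semi_invE.
  rewrite big_split rmorphD /= /c coset_cocycleM // coset_cocycleV // -/c; congr (_ + _).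
    rewrite sumrN rmorphN /= -sum_u; congr (- _%:~R).
    exact: (sum_shift (u x).1 (phi (e x) *: A)%g (phi (e x))).
  rewrite invgK -IH1; last exact: is_coset_act.
  by congr (_%:~R); exact: (sum_shift (h g).1 (phi (e x) *: A)%g (phi (e x))).
exists (fun g z => (h g).1 (H : {set P}, z)); split=> [g g' z gH | g gH].
  rewrite gmulfM semi_mulE (inv g).1; congr (_ + (h g').1 (_, _)).
  by apply: lcoset_id; rewrite groupV.
rewrite (inv g).2; first exact: coset_cocycle_base.
by exists 1%g; rewrite lcoset1.
Qed.

End CocycleLift.

(** * Cocycles of limit groups *)

Section PGroupHoms.
Import GRing.Theory.
Local Open Scope group_scope.
Local Open Scope ring_scope.

(** The discrete logarithm in the cyclic quotient [H / N] of order [q], with value 0 outside [H]. *)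
Lemma maximal_additive (q : nat) (P : finGroupType) (H N : {group P}) :
    prime q -> (q.-group H)%g -> maximal N H ->
  exists al : P -> 'F_q, {in H &, forall x y, al (x * y)%g = al x + al y} /\
    forall x, x \in H -> (al x == 0) = (x \in N).
Proof.
move=> q_pr qH maxN; have nN : (N <| H)%g := p_maximal_normal qH maxN.
have nHN := subsetP (normal_norm nN).
have cardQ : #|(quotient H N)| = q.
  by rewrite card_quotient ?normal_norm // (p_maximal_index qH maxN).
have /cyclicP[u Hu] : cyclic (quotient H N) by apply: prime_cyclic; rewrite cardQ.
have ou : #[u]%g = q by rewrite orderE -Hu cardQ.
have kP x : x \in H -> exists k, coset N x == (u ^+ k)%g.
  move=> xH; have : coset N x \in <[u]>%g by rewrite -Hu mem_quotient.
  by case/cycleP=> k ->; exists k.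
pose k x := if pselect (x \in H) is left xH then xchoose (kP x xH) else 0%N.
have kE x : x \in H -> coset N x = (u ^+ k x)%g.
  by move=> xH; rewrite /k; case: pselect => // xH'; apply/eqP/(xchooseP (kP x xH')).
have natF (a : nat) : (a%:R == 0 :> 'F_q) = (q %| a)%N.
  by rewrite (dvdn_pcharf (pchar_Fp q_pr)).
exists (fun x => (k x)%:R); split=> [x y xH yH | x xH].
  have : (u ^+ k (x * y) == u ^+ (k x + k y))%g.
    by rewrite expgnDr -!kE ?groupM // morphM ?nHN.
  rewrite eq_expg_mod_order ou => /eqP e.
  by rewrite -natrD -(Fp_nat_mod q_pr) e Fp_nat_mod.
rewrite natF -ou order_dvdn -kE //.
by apply/eqP/idP => [/coset_idr|/coset_id //]; apply; exact: nHN.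
Qed.

(** For [a] outside a maximal subgroup [N1], the abelian subgroup generated by [a] is proper, so it
    lies in a second maximal subgroup [N2]. Evaluation at [a] and at some [b] in [N1] but not in
    [N2] separates the homomorphisms with these kernels. *)
Lemma nonabelian_two_additive (q : nat) (P : finGroupType) (H : {group P}) :
    prime q -> (q.-group H)%g -> ~~ abelian H ->
  exists al : bool -> P -> 'F_q,
    (forall b, {in H &, forall x y, al b (x * y)%g = al b x + al b y}) /\
    forall c : bool -> 'F_q, (forall x, x \in H -> \sum_b c b * al b x = 0) -> c =1 (fun=> 0).
Proof.
move=> q_pr qH nabH.
have maxex (K : {group P}) : K \proper H -> exists2 N : {group P}, maximal N H & K \subset N.
  by move=> KH; have [N] := maxgroup_exists (gP := fun L : {group P} => L \proper H) KH; exists N.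
have [N1 max1 _] : exists2 N : {group P}, maximal N H & 1%G \subset N.
  apply: maxex; rewrite properE sub1G /=; apply: contra nabH => /trivgP ->.
  exact: abelian1.
have /properP[s1 [a aH aN1]] : N1 \proper H := maxgroupp max1.
have [N2 max2 sa2] : exists2 N : {group P}, maximal N H & <[a]>%G \subset N.
  apply: maxex; rewrite properE cycle_subG aH /=; apply: contra nabH => sH.
  exact: abelianS sH (cycle_abelian a).
have aN2 : a \in N2 by rewrite -cycle_subG.
have [b bN1 bN2] : exists2 b, b \in N1 & b \notin N2.
  apply/subsetPn; apply/negP => s12; have /maxgroupP[_ h] := max1.
  by move: aN1; rewrite -(h N2 (maxgroupp max2) s12) aN2.
have bH : b \in H by apply: (subsetP s1).
have [al1 [M1 K1]] := maximal_additive q_pr qH max1.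
have [al2 [M2 K2]] := maximal_additive q_pr qH max2.
exists (fun b : bool => if b then al1 else al2); split; first by case.
move=> c h.
have a2 : al2 a = 0 by apply/eqP; rewrite K2.
have b1 : al1 b = 0 by apply/eqP; rewrite K1.
have := h a aH; rewrite big_bool /= a2 mulr0 addr0 => /eqP.
rewrite mulf_eq0 K1 // (negPf aN1) orbF => /eqP c1.
have := h b bH; rewrite big_bool /= b1 mulr0 add0r => /eqP.
rewrite mulf_eq0 K2 // (negPf bN2) orbF => /eqP c2.
by case.
Qed.

End PGroupHoms.

Section LowerBound.
Import GRing.Theory.
Local Open Scope group_scope.
Local Open Scope ring_scope.
Variables (G : groupType) (d : nat) (x : 'I_d -> G).

Lemma additive_wprod (V : zmodType) (al : G -> V) w :
  (forall g h, al (g * h)%g = al g + al h) -> (forall i, al (x i) = 0) ->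
  al (wprod x w) = 0.
Proof.
move=> alM al0; elim: w => [|i w IHw] /=; last by rewrite alM al0 IHw addr0.
have /eqP := alM 1%g 1%g; rewrite mulg1.
by rewrite -{1}[al _]addr0 (inj_eq (addrI _)) eq_sym => /eqP.
Qed.

(* The right translates of the two cocycles [dl b] by [P] are linearly independent
   modulo [q]: otherwise the [q]-group [P] would fix a nonzero linear relation
   between them, and summing over [P] gives a relation between the [al b]. *)
Lemma translate_nullity_bound (q : nat) (P : finGroupType) (phi : G -> P)
    (L : seq (seq 'I_d * seq 'I_d))
    (dl : bool -> G -> P -> int) (al : bool -> G -> 'F_q) :
    prime q -> (q.-group [set: P])%g -> (forall g h, phi (g * h)%g = (phi g * phi h)%g) ->
    (forall r, r \in L -> wprod x r.1 = wprod x r.2) ->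
    (forall b, cocycle (mul_act phi) (dl b)) ->
    (forall b g, (\sum_z dl b g z)%:~R = al b g) ->
    (forall c : bool -> 'F_q, (forall i, \sum_b c b * al b (x i) = 0) -> c =1 fun=> 0) ->
  (2 * #|P| <= nullity (gr_matrix rat (mul_act phi) (relmx x L)))%N.
Proof.
move=> q_pr qP phiM relL cdl sumdl indep.
have actP := mul_actP phiM.
pose Rm (k : nzRingType) : 'M[k]_(#|{: bool * P}|, #|{: 'I_d * P}|) :=
  map_mx intr (fmx (fun (a : bool * P) (b : 'I_d * P) => dl a.1 (x b.1) (b.2 * a.2)%g)).
have RmE (k : fieldType) (u : bool * P -> k) :
    frow u *m Rm k = frow (fun b => \sum_a u a * (dl a.1 (x b.1) (b.2 * a.2)%g)%:~R).
  by rewrite /Rm map_fmx frow_mul.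
have rkq : \rank (Rm 'F_q) = (2 * #|P|)%N.
  (* [pgroup_rank_bound] with [Z = 0]: the kernel vanishes as soon as it has no nonzero fixed
     vector. *)
  have : (\rank (kermx (Rm 'F_q)) <= #|[set: P]| * \rank (0%R : 'rV['F_q]_#|{: bool * P}|))%N.
    pose sh (y : P) (a : bool * P) := (a.1, (y^-1 * a.2)%g).
    pose rho (y : P) : 'M['F_q]_#|{: bool * P}| := fmx (fun a b => (b == sh y a)%:R).
    have shK y : cancel (sh y) (sh y^-1%g) by case=> b z; rewrite /sh /= invgK mulVKg.
    have shVK y : cancel (sh y^-1%g) (sh y) by case=> b z; rewrite /sh /= invgK mulKg.
    have rhoE (u : bool * P -> 'F_q) y : frow u *m rho y = frow (u \o sh y^-1%g).
      exact: frow_fun_mul.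
    apply: (@pgroup_rank_bound _ q P _ rho q_pr (pchar_Fp q_pr) _ _ [set: P]%G qP).
    - rewrite scalar_fmx; apply: eq_fmx => -[i z] b.
      by rewrite /sh /= invg1 mul1g eq_sym.
    - move=> y1 y2; rewrite fmx_fun_mul; apply: eq_fmx => -[i z] b.
      by rewrite /sh /= invMg mulgA.
    - move=> y _; apply/rV_subP => v /submxP[c ->]; rewrite mulmxA.
      have : (c *m kermx (Rm 'F_q) <= kermx (Rm 'F_q))%MS by apply: submxMl.
      move: (c *m _) => u0; rewrite (frow_eta u0) rhoE.
      set u := fun i => _; move=> /sub_kermxP; rewrite RmE => ku.
      apply/sub_kermxP; rewrite RmE; apply/rowP => i; rewrite !mxE.
      case: (enum_val i) => j z /=.
      apply: etrans (frow0P ku (j, (z * y^-1)%g)) => /=.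
      rewrite [RHS](reindex (fun a : bool * P => (a.1, (y * a.2)%g))) /=.
        by apply: eq_bigr => -[b y'] _; rewrite /sh /= invgK !mulgA mulgVK.
      exists (fun a : bool * P => (a.1, (y^-1 * a.2)%g)) => -[b y'] _ /=.
        by rewrite mulKg.
      by rewrite mulVKg.
    move=> v; rewrite (frow_eta v); set u := fun i => _ => /sub_kermxP; rewrite RmE => ku fixu.
    have uE b y : u (b, y) = u (b, 1%g).
      have := fixu y (in_setT y); rewrite rhoE => /frow_inj /(_ (b, 1%g)) <-.
      by rewrite /sh /= invgK mulg1.
    suff u0 : (fun b => u (b, 1%g)) =1 fun=> 0.
      rewrite (_ : frow u = 0) ?sub0mx //; apply/rowP => i; rewrite !mxE.
      by case: (enum_val i) => b y; rewrite uE u0.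
    apply: indep => i.
    apply: etrans (frow0P ku (i, 1%g)) => /=; symmetry.
    transitivity (\sum_b \sum_y u (b, y) * (dl b (x i) (1 * y)%g)%:~R).
      by rewrite pair_bigA; apply: eq_bigr => -[].
    apply: eq_bigr => b _; rewrite -sumdl rmorph_sum mulr_sumr.
    by apply: eq_bigr => y _; rewrite uE mul1g.
  rewrite mxrank0 muln0 leqn0 mxrank_ker subn_eq0 => h.
  apply/eqP; rewrite eqn_leq.
  have -> : (2 * #|P| = #|{: bool * P}|)%N by rewrite card_prod card_bool.
  by rewrite h rank_leq_row.
have := mxrank_modp_le
  (fmx (fun (a : bool * P) (b : 'I_d * P) => dl a.1 (x b.1) (b.2 * a.2)%g)) q_pr.
rewrite -/(Rm 'F_q) -/(Rm rat) rkq => /leq_trans; apply.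
rewrite nullityE; apply: mxrankS; apply/row_subP => a.
rewrite (frow_eta (row a _)); apply/(gr_kerP _ _ actP)/(relmx_kerP _ _ _ actP) => r rL z.
rewrite -(enum_valK a); case: (enum_val a) => b y.
pose dly g (z : P) : rat := (dl b g (z * y)%g)%:~R.
have cdly : cocycle (mul_act phi) dly.
  by move=> g h z'; rewrite /dly cdl rmorphD /= /mul_act mulgA.
have foxE w : fox x (mul_act phi) (fun i => row (enum_rank (b, y)) (Rm rat) 0 (enum_rank i)) w z =
    dly (wprod x w) z.
  rewrite -(cocycle_fox _ _ _ actP cdly); elim: w z => //= i w IHw z.
  by rewrite IHw !mxE !enum_rankK.
by rewrite !foxE relL.
Qed.

End LowerBound.

Section Core.
Import Order.TTheory GRing.Theory Num.Theory.
Local Open Scope group_scope.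
Local Open Scope ring_scope.

Lemma monoid_generators (G : groupType) : finitely_generated G ->
  exists (d : nat) (x : 'I_d -> G), forall g, exists w, wprod x w = g.
Proof.
case=> s sG; pose t := s ++ [seq y^-1%g | y <- s].
exists (size t), (tnth (in_tuple t)) => g.
have mt y : y \in t -> exists i, tnth (in_tuple t) i = y.
  by move=> /(tnthP (in_tuple t)) [i ->]; exists i.
elim/gen_ind: {g}(sG g) => [|y g ys [w <-]|y g ys [w <-]]; first by exists [::].
  by have [|i <-] := mt y; [rewrite mem_cat ys | exists (i :: w)].
have [|i iy] := mt y^-1%g; last by exists (i :: w); rewrite /= iy.
by rewrite mem_cat (map_f (fun y => y^-1%g) ys) orbT.
Qed.

Lemma limit_nullity_bound (G : groupType) (d : nat) (x : 'I_d -> G)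
    (L : seq (seq 'I_d * seq 'I_d)) (T : seq G) (N : nat) :
    limit_group G -> ~ abelian_group G ->
    (forall g, exists w, wprod x w = g) ->
    (forall r, r \in L -> wprod x r.1 = wprod x r.2) ->
  exists q (P : finGroupType) (phi : G -> P),
    [/\ (prime q /\ (N < q)%N), (q.-group [set: P])%g,
        (forall g h, phi (g * h)%g = (phi g * phi h)%g),
        (forall g, g \in T -> g != 1%g -> phi g != 1%g) &
        (2 * #|P| <= nullity (gr_matrix rat (mul_act phi) (relmx x L)))%N].
Proof.
move=> [_ limG] nabG genx relL.
have [a [b ab]] : exists a b : G, [~ a, b]%g != 1%g.
  apply: contrapT => h; apply: nabG => a b; apply/commgP; apply: contrapT => ne.
  by apply: h; exists a, b; apply/negP.
(* The commutator keeps the image non-abelian; with 1 in the list, injectivity says that nontrivial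
   elements stay nontrivial. *)
have [F freeF [f f_inj]] := limG [:: 1%g, [~ a, b]%g & T].
have [N2 resF] := free_residually_p [seq f g | g <- [~ a, b]%g :: T] freeF.
have [q ltq q_pr] := prime_above (maxn N N2).
move: ltq; rewrite gtn_max => /andP[ltN ltN2].
have [P [psi [qP psiM psi1]]] := resF q q_pr ltN2.
pose phi g := psi (f g).
have phiM g h : phi (g * h)%g = (phi g * phi h)%g by rewrite /phi gmulfM psiM.
have phi_one : phi 1%g = 1%g by apply: (mulgI (phi 1%g)); rewrite -phiM !mulg1.
have phiV g : phi g^-1%g = (phi g)^-1%g.
  by apply: (mulgI (phi g)); rewrite -phiM !mulgV.
have phiT g : g \in [~ a, b]%g :: T -> g != 1%g -> phi g != 1%g.
  move=> gT g1; apply: psi1; first by rewrite map_f.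
  apply: contraNneq g1 => fg1; apply/eqP; apply: f_inj; rewrite ?inE ?eqxx //.
    by move: gT; rewrite inE => ->; rewrite orbT.
  by rewrite fg1 gmulf1.
exists q, P, phi; split=> //.
  by move=> g gT; apply: phiT; rewrite inE gT orbT.
(* The homomorphisms to ['F_q] are taken on the image of [phi], which may be smaller than [P]: there
   independence can be tested on the generators of [G]. *)
have gH : group_set [set y : P | `[< exists g, phi g = y >]].
  apply/group_setP; split=> [|y z]; rewrite !in_set.
    by apply/asboolP; exists 1%g.
  by move=> /asboolP[g <-] /asboolP[h <-]; apply/asboolP; exists (g * h)%g.
pose H := group gH.
have phiH g : phi g \in H by rewrite in_set; apply/asboolP; exists g.
have qH : (q.-group H)%g by apply: pgroupS qP; apply: subsetT.
have nabH : ~~ abelian H.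
  apply/negP => /centsP abH; have := phiT _ (mem_head _ _) ab.
  rewrite /commg /conjg !phiM !phiV.
  by rewrite -(abH _ (phiH b) _ (phiH a)) !mulgA mulgVK mulVg eqxx.
have [al [alM al_ind]] := nonabelian_two_additive q_pr qH nabH.
have lift c : exists dl : F -> P -> int,
    (forall g h z, psi g \in H -> dl (g * h)%g z = dl g z + dl h ((psi g)^-1 * z)%g) /\
    (forall g, psi g \in H -> (\sum_z dl g z)%:~R = al c (psi g)).
  exact: cocycle_lift freeF psiM (alM c).
pose dl c g := projT1 (cid (lift c)) (f g).
have cdl c : cocycle (mul_act phi) (dl c).
  move=> g h z; rewrite /dl; case: cid => /= D [h1 _].
  by rewrite gmulfM h1 ?phiH // /mul_act phiV.
apply: (translate_nullity_bound (q := q) (dl := dl) (al := fun c g => al c (phi g))) => //.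
  by move=> c g; rewrite /dl; case: cid => /= D [_ ->]; rewrite ?phiH.
move=> c c0; apply: al_ind => y; rewrite in_set => /asboolP[g <-].
have [w <-] := genx g.
apply: (additive_wprod (x := x) (al := fun g => \sum_b0 c b0 * al b0 (phi g))) => //.
move=> g1 g2; rewrite -big_split /=; apply: eq_bigr => b0 _.
by rewrite phiM alM ?phiH // mulrDr.
Qed.

Lemma card_fix_mul_act (G : groupType) (P : finGroupType) (phi : G -> P) g :
  #|[pred z | mul_act phi g z == z]| = ((phi g == 1%g) * #|P|)%N.
Proof.
have [e|ne] := eqVneq (phi g) 1%g.
  by rewrite mul1n; apply: eq_card => z; rewrite !inE /mul_act e mul1g eqxx.
rewrite mul0n; apply: eq_card0 => z; rewrite !inE /mul_act.
by apply: contraNF ne => /eqP e; apply/eqP; apply: (mulIg z); rewrite mul1g.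
Qed.

Lemma card_fix_prod_act (G : groupType) (Om C : finType) (act : G -> Om -> Om)
    (act' : G -> C -> C) g :
  #|[pred w | prod_act act act' g w == w]| =
  (#|[pred w | act g w == w]| * #|[pred c | act' g c == c]|)%N.
Proof.
rewrite -cardX /=; apply: eq_card => -[w c].
by rewrite !inE /prod_act xpair_eqE.
Qed.

(* If there is no such cocycle, the sum-zero part of the kernel of the relation
   matrix on [C] has dimension less than [#|C|], so that on [P * C] it has dimension
   at most [#|P| * (#|C| - 1)]; the kernel on [P] has dimension at least [2 * #|P|],
   and the kernel on [P * C] is nearly [#|C|] times that by [nullity_comparison]. *)
Lemma limit_group_cocycle (G : groupType) (C : finType) (act : G -> C -> C) (r : C -> G) :
    limit_group G -> ~ abelian_group G -> is_act act -> (1 < #|C|)%N ->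
  exists dl : G -> C -> rat, [/\ cocycle act dl, (forall g, \sum_c dl g c = 0),
    (forall c', \sum_c dl (r c) c' = 0) & exists g c, dl g c <> 0].
Proof.
move=> limG nabG actC C1; apply: contrapT => no.
have no_dl (dl : G -> C -> rat) : cocycle act dl -> (forall g, \sum_c dl g c = 0) ->
    (forall c', \sum_c dl (r c) c' = 0) -> forall g c, dl g c = 0.
  move=> h1 h2 h3 g c; apply: contrapT => nz; apply: no; exists dl; split=> //.
  by exists g, c.
have [d [x genx]] := monoid_generators limG.1.
have [L relL fullL] := finite_relations x rat actC.
have nulC := cocycle_nullity_bound genx actC (ltnW C1) fullL no_dl.
have [N modq] := mxrank_modp_eq (fmx (gr_aug act (fun=> tt) (relmx x L))).
(* With n = |P|, p = |C| and z >= 2 n the nullity on [P], the estimates below give j (p - 1) z <= j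
   n (p - 1) + 2 d n p, hence j (p - 1) <= 2 d p <= 4 d (p - 1) because p >= 2. So any j above 4 d
   is contradictory. *)
have [S cmpS] := nullity_comparison (relmx x L) (j := (4 * d).+1) isT.
have [q [P [phi [[q_pr ltq] qP phiM phiS low]]]] :=
  limit_nullity_bound S N limG nabG genx relL.
have actP := mul_actP phiM.
have actPC := prod_actP actP actC.
have fix1 g : g \in S -> #|[pred w | prod_act (mul_act phi) act g w == w]| =
    (#|C| * #|[pred z | mul_act phi g z == z]|)%N.
  move=> gS; rewrite card_fix_prod_act card_fix_mul_act.
  have [->|g1] := eqVneq g 1%g.
    rewrite mulnC; congr (_ * _)%N; apply: eq_card => c.
    by rewrite !inE actC.1 eqxx.
  by rewrite (negPf (phiS _ gS g1)) !mul0n muln0.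
have h1 := cmpS _ _ _ _ _ actP actPC fix1.
have h2 := nullity_fibration rat (relmx x L) actPC actP (pr := fst) (fun _ _ => erefl).
have h3 : (nullity (gr_aug_matrix rat (prod_act (mul_act phi) act) fst (relmx x L)) <=
    nullity (gr_aug_matrix 'F_q (prod_act (mul_act phi) act) fst (relmx x L)))%N.
  by rewrite /nullity leq_sub2l // mxrank_modp_le.
have h4 := pgroup_nullity_bound (relmx x L) q_pr (pchar_Fp q_pr) qP phiM actC.
have h5 : (nullity (gr_aug_matrix 'F_q act (fun=> tt) (relmx x L)) < #|C|)%N.
  by rewrite /nullity (modq q).
have P0 : (0 < #|P|)%N by apply/card_gt0P; exists 1%g.
have cPC : #|{: P * C}| = (#|P| * #|C|)%N by rewrite card_prod.
move: h1 h2 h3 h4 h5 low; rewrite /gr_matrix.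
set z := nullity _; set z' := nullity _; set y := nullity _.
set y' := nullity _; set v := nullity _.
rewrite card_ord cPC.
move: z z' y y' v C1 P0; move: #|P| #|C| => n p z z' y y' v C1 n0 h1 h2 h3 h4 h5 h6.
have h7 : (y' <= n * p.-1)%N by apply: leq_trans h4 _; rewrite leq_mul2l; lia.
have [p' ep] : exists p', p = p'.+2 by exists (p - 2)%N; lia.
move: h1 h7; rewrite ep /= => h1 h7.
nia.
Qed.

End Core.

(** * The rational rank *)

Section Dimension.
Import GRing.Theory.
Local Open Scope ring_scope.
Variables (K : fieldType) (V : lmodType K).

Definition spans n (b : 'I_n -> V) : Prop :=
  forall v, exists c : 'I_n -> K, v = \sum_(i < n) c i *: b i.

(** A spanning family of least size is free: a nontrivial relation would express one member by the
    others. *)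
Lemma basis_of_spans m (s : 'I_m -> V) : spans s -> exists n (b : 'I_n -> V), is_basis b.
Proof.
move=> sp; have exn : exists n, `[< exists b : 'I_n -> V, spans b >].
  by exists m; apply/asboolP; exists s.
have [n /asboolP[b bsp] minn] := ex_minnP exn.
exists n, b; split=> // c c0 i; apply: contrapT => /eqP ci.
case: n b bsp minn c c0 i ci => [|n] b bsp minn c c0 i ci; first by case: (i).
suff : (n.+1 <= n)%N by rewrite ltnn.
apply: minn; apply/asboolP; exists (fun j => b (lift i j)) => v.
have [a ->] := bsp v.
exists (fun j => a (lift i j) - a i * (c i)^-1 * c (lift i j)).
have bi : b i = - \sum_(j < n) ((c i)^-1 * c (lift i j)) *: b (lift i j).
  have := c0; rewrite (bigD1_ord i) //= => /eqP.
  rewrite addr_eq0 => /eqP /(congr1 (fun w => (c i)^-1 *: w)).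
  rewrite scalerA mulVf // scale1r scalerN scaler_sumr => ->.
  by congr (- _); apply: eq_bigr => j _; rewrite scalerA.
rewrite (bigD1_ord i) //= bi scalerN scaler_sumr -sumrN -big_split /=.
apply: eq_bigr => j _; rewrite scalerBl addrC scalerA.
by rewrite mulrA.
Qed.

(** A finite spanning family keeps [dimension] off its default value. *)
Lemma dimension_basis m (s : 'I_m -> V) : spans s ->
  exists b : 'I_(dimension V) -> V, is_basis b.
Proof.
move=> /basis_of_spans [n [b bP]].
by apply: (xgetPex 0%N (P := [set n | exists b : 'I_n -> V, is_basis b]%classic)); exists n, b.
Qed.

Lemma basis_coordinates n (b : 'I_n -> V) : is_basis b ->
  exists co : V -> 'I_n -> K,
    [/\ forall v w i, co (v - w) i = co v i - co w i, forall v w i, co (v + w) i = co v i + co w i,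
        forall a v i, co (a *: v) i = a * co v i &
        forall k i, co (b k) i = (i == k)%:R].
Proof.
move=> [bfree bspan].
pose co v := projT1 (cid (bspan v)).
have coE v : v = \sum_i co v i *: b i := projT2 (cid (bspan v)).
have co_uniq v c i : v = \sum_i c i *: b i -> co v i = c i.
  move=> vc; apply/eqP; rewrite -subr_eq0; apply/eqP.
  apply: (bfree (fun i => co v i - c i)).
  transitivity (\sum_i co v i *: b i - \sum_i c i *: b i); last by rewrite -coE -vc subrr.
  by rewrite -sumrB; apply: eq_bigr => j _; rewrite scalerBl.
exists co; split=> [v w i|v w i|a v i|k i].
- apply: (co_uniq _ (fun i => co v i - co w i)); rewrite {1}(coE v) {1}(coE w) -sumrB.
  by apply: eq_bigr => j _; rewrite scalerBl.
- apply: (co_uniq _ (fun i => co v i + co w i)); rewrite {1}(coE v) {1}(coE w) -big_split.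
  by apply: eq_bigr => j _; rewrite scalerDl.
- apply: (co_uniq _ (fun i => a * co v i)); rewrite {1}(coE v) scaler_sumr.
  by apply: eq_bigr => j _; rewrite scalerA.
apply: (co_uniq _ (fun i => (i == k)%:R)).
rewrite (bigD1 k) //= eqxx scale1r big1 ?addr0 // => j /negPf ->.
by rewrite scale0r.
Qed.

End Dimension.

Section HomologyDuality.
Import GRing.Theory.
Local Open Scope quotient_scope.
Local Open Scope ring_scope.
Variable H : groupType.

Definition H1Q : lmodType rat := tensor (abelianization H) rat^o.

Definition h1 (h : H) : H1Q := tens (\pi_(abelianization H) h) (1 : rat^o).

Lemma h1M (g h : H) : h1 (g * h)%g = h1 g + h1 h.
Proof. by rewrite /h1 -tensDl; congr (tens _ _); rewrite -[RHS]/(ab_add _ _) !piE. Qed.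

Lemma h1_1 : h1 1%g = 0.
Proof. by apply: (addrI (h1 1%g)); rewrite -h1M mulg1 addr0. Qed.

Lemma h1_ind (Q : H1Q -> Prop) : Q 0 -> (forall x y, Q x -> Q y -> Q (x - y)) ->
  (forall c h, Q (c *: h1 h)) -> forall v, Q v.
Proof.
move=> Q0 QB Qh; apply: tensor_ind => // a b.
have -> : tens a b = b *: h1 (generic_quotient.repr a); last exact: Qh.
rewrite /h1 reprK -[b *: _]/(tscale _ _) tscaleE.
by rewrite -[b *: 1]/(b * 1) mulr1.
Qed.

(** [psi] kills commutators, so it descends to the abelianization, and then to the tensor product
    through the biadditive map (a, c) to psi(a) c. *)
Lemma h1_functional (psi : H -> rat) : (forall g h, psi (g * h)%g = psi g + psi h) ->
  exists Psi : H1Q -> rat, (forall c v w, Psi (c *: v + w) = c * Psi v + Psi w) /\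
    forall h, Psi (h1 h) = psi h.
Proof.
move=> psiM.
have psi1 : psi 1%g = 0 by apply: (addrI (psi 1%g)); rewrite -psiM mulg1 addr0.
have psiV g : psi g^-1%g = - psi g by apply: (addrI (psi g)); rewrite -psiM mulgV psi1 subrr.
have psi_der g : g \in derived H -> psi g = 0.
  elim/gen_ind => // x h /asboolP [y [z ->]] h0; rewrite psiM h0 addr0.
    by rewrite /commg /conjg !psiM !psiV addrCA addKr addNr.
  by rewrite psiV /commg /conjg !psiM !psiV addrCA addKr addNr oppr0.
pose psiab (a : abelianization H) : rat := psi (generic_quotient.repr a).
have psiabE h : psiab (\pi_(abelianization H) h) = psi h.
  have /(ab_eqP _ _)/psi_der :
      generic_quotient.repr (\pi_(abelianization H) h) = h %[mod abelianization H].
    by rewrite reprK.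
  by rewrite psiM psiV addrC => /eqP; rewrite subr_eq0 => /eqP ->.
have psiabD a b : psiab (a + b) = psiab a + psiab b.
  rewrite -[a]reprK -[b]reprK -[_ + _]/(ab_add _ _) !piE !psiabE.
  by rewrite psiM.
pose f (a : abelianization H) (c : rat^o) : rat := psiab a * c.
have fbi : biadditive f.
  by split=> [c a a'|a c c']; rewrite /f ?psiabD ?mulrDl ?mulrDr.
pose Psi : H1Q -> rat := tlift f.
have PsiB v w : Psi (v - w) = Psi v - Psi w by exact: (tlift_is_zmod_morphism fbi).
have Psi0 : Psi 0 = 0 by have := PsiB 0 0; rewrite !subrr.
have PsiN v : Psi (- v) = - Psi v by rewrite -sub0r PsiB Psi0 sub0r.
have PsiZ c v : Psi (c *: v) = c * Psi v.
  move: v; apply: tensor_ind => [|v w IHv IHw|a b].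
  - by rewrite scaler0 Psi0 mulr0.
  - by rewrite scalerBr !PsiB IHv IHw mulrBr.
  - rewrite -[c *: _]/(tscale _ _) tscaleE /Psi !tliftE // /f.
    by rewrite -[c *: b]/(c * b) mulrCA.
exists Psi; split=> [c v w|h].
  by rewrite -[w in LHS]opprK PsiB PsiN opprK PsiZ.
by rewrite /Psi /h1 tliftE // /f psiabE mulr1.
Qed.

Lemma h1_spans : finitely_generated H -> exists m (s : 'I_m -> H1Q), spans s.
Proof.
move=> /monoid_generators [d [x genx]]; exists d, (fun i => h1 (x i)).
apply: h1_ind => [|v w [a ->] [b ->]|c h].
- by exists (fun=> 0); rewrite big1 // => i _; rewrite scale0r.
- exists (fun i => a i - b i); rewrite -sumrB; apply: eq_bigr => i _.
  by rewrite scalerBl.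
have [w <-] := genx h; elim: w => [|i w [a IHw]] /=.
  by exists (fun=> 0); rewrite h1_1 scaler0 big1 // => i _; rewrite scale0r.
exists (fun j => a j + c *+ (j == i)); rewrite h1M scalerDr IHw addrC.
under [RHS]eq_bigr do rewrite scalerDl.
rewrite big_split /=; congr (_ + _); rewrite (bigD1 i) //= eqxx big1 ?addr0 //.
by move=> j /negPf ->; rewrite scale0r.
Qed.

End HomologyDuality.

Section RankComparison.
Import GRing.Theory.
Local Open Scope ring_scope.

(** The homomorphisms are the coordinates in a basis of H_1. With [rkQ_lower_bound], ranks can be
    compared through independent homomorphisms to [rat]. *)
Lemma rkQ_hom_basis (G : groupType) : finitely_generated G ->
  exists psi : 'I_(rkQ G) -> G -> rat,
    (forall i g h, psi i (g * h)%g = psi i g + psi i h) /\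
    forall c : 'I_(rkQ G) -> rat, (forall g, \sum_i c i * psi i g = 0) -> c =1 fun=> 0.
Proof.
move=> /h1_spans [m [s sP]]; have [b bP] := dimension_basis sP.
have [co [coB coD coZ cob]] := basis_coordinates bP.
have co0 i : co 0 i = 0 by rewrite -(subrr 0) coB subrr.
exists (fun i g => co (h1 g) i); split=> [i g h|c c0 k]; first by rewrite h1M coD.
have all0 v : \sum_i c i * co v i = 0.
  move: v; apply: h1_ind => [|v w IHv IHw|a g].
  - by rewrite big1 // => i _; rewrite co0 mulr0.
  - transitivity (\sum_i c i * co v i - \sum_i c i * co w i); last by rewrite IHv IHw subrr.
    by rewrite -sumrB; apply: eq_bigr => i _; rewrite coB mulrBr.
  - transitivity (a * \sum_i c i * co (h1 g) i); last by rewrite c0 mulr0.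
    by rewrite mulr_sumr; apply: eq_bigr => i _; rewrite coZ mulrCA.
rewrite -[RHS](all0 (b k)) (bigD1 k) //= cob eqxx mulr1 big1 ?addr0 // => i /negPf e.
by rewrite cob e mulr0.
Qed.

(** The matrix of the extended functionals on a basis of H_1 has trivial left kernel, so it has at
    most as many rows as columns. *)
Lemma rkQ_lower_bound (G : groupType) (I : finType) (chi : I -> G -> rat) :
    finitely_generated G ->
    (forall i g h, chi i (g * h)%g = chi i g + chi i h) ->
    (forall c : I -> rat, (forall g, \sum_i c i * chi i g = 0) -> c =1 fun=> 0) ->
  (#|I| <= rkQ G)%N.
Proof.
move=> /h1_spans [m [s sP]] chiM indep; have [b [_ bspan]] := dimension_basis sP.
pose Psi i := projT1 (cid (h1_functional (chiM i))).
have PsiL i a v w : Psi i (a *: v + w) = a * Psi i v + Psi i w.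
  by rewrite /Psi; case: cid => /= P [].
have PsiE i g : Psi i (h1 g) = chi i g by rewrite /Psi; case: cid => /= P [].
have Psi0 i : Psi i 0 = 0.
  by apply: (addrI (Psi i 0)); rewrite -{1}[Psi i 0]mul1r -PsiL scaler0 !addr0.
have Psi_sum i n (a : 'I_n -> rat) (v : 'I_n -> H1Q G) :
    Psi i (\sum_k a k *: v k) = \sum_k a k * Psi i (v k).
  elim/big_rec2: _ => [|k x y _ <-]; first exact: Psi0.
  by rewrite PsiL.
pose X : 'M[rat]_(#|I|, #|'I_(rkQ G)|) := fmx (fun i k => Psi i (b k)).
have kX : kermx X = 0.
  apply/eqP; rewrite -submx0; apply: frow_subP => c /sub_kermxP.
  rewrite frow_mul => /frow0P c0.
  rewrite (_ : frow c = 0) ?sub0mx //; apply/rowP => i; rewrite !mxE; apply: (indep c) => g.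
  have [a ga] := bspan (h1 g).
  transitivity (\sum_k a k * (\sum_i c i * Psi i (b k))); last first.
    by rewrite big1 // => k _; rewrite c0 mulr0.
  under [RHS]eq_bigr do rewrite mulr_sumr.
  rewrite exchange_big /=; apply: eq_bigr => j _.
  rewrite -PsiE ga Psi_sum mulr_sumr; apply: eq_bigr => k _.
  by rewrite mulrCA.
have := mxrank_ker X; rewrite kX mxrank0 => /esym/eqP; rewrite subn_eq0 => h.
by apply: leq_trans h _; apply: leq_trans (rank_leq_col X) _; rewrite card_ord.
Qed.

End RankComparison.

(** * Normal subgroups of finite index *)

Section FiniteIndex.
Import Order.TTheory GRing.Theory Num.Theory.
Local Open Scope group_scope.
Local Open Scope ring_scope.

Lemma has_index_cosets (G : groupType) (U : groupClosed G) p : has_index U p ->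
  exists2 kap : G -> 'I_p, (forall g h, (kap g == kap h) = (g^-1 * h \in U)%g) &
    forall c, exists g, kap g = c.
Proof.
move=> /card_set_bijP [f [ff fi fs]].
have fp g : (f (Defs.lcoset U g) < p)%N by apply: (ff (Defs.lcoset U g)); exists g.
exists (fun g => Ordinal (fp g)) => [g h|c].
  apply/eqP/idP => [/(congr1 val)/= e|ghU].
    have : Defs.lcoset U g = Defs.lcoset U h.
      by apply: fi => //; apply/mem_set; [exists g | exists h].
    move/(congr1 (fun A : set G => A h)); rewrite /Defs.lcoset /= mulVg => ->.
    exact: gpred1.
  apply: val_inj; congr (f _); apply/seteqP; split=> k; rewrite /Defs.lcoset /=.
    have -> : (h^-1 * k = (g^-1 * h)^-1 * (g^-1 * k))%g by rewrite invgM invgK !mulgA mulgK.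
    by move=> gk; rewrite gpredM ?gpredV.
  have -> : (g^-1 * k = (g^-1 * h) * (h^-1 * k))%g by rewrite !mulgA mulgK.
  by move=> hk; rewrite gpredM.
have [A [g _ <-] e] := fs c (ltn_ord c).
by exists g; apply: val_inj.
Qed.

Lemma sum_option (V : nmodType) (I : finType) (F : option I -> V) :
  \sum_o F o = F None + \sum_i F (Some i).
Proof.
rewrite (bigD1 None) //= (reindex_omap Some id) => [|[]//].
by congr (_ + _); apply: eq_bigl => i; rewrite eqxx.
Qed.

Variables (G : groupType) (U : groupClosed G) (C : finType) (kap : G -> C).
Hypotheses (nU : normal_subgroup U)
  (kapE : forall g h, (kap g == kap h) = (g^-1 * h \in U)%g)
  (kap_surj : forall c, exists g, kap g = c).

Definition rep (c : C) : G := projT1 (cid (kap_surj c)).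

Lemma kap_rep c : kap (rep c) = c. Proof. exact: projT2 (cid (kap_surj c)). Qed.

Definition coset_act (g : G) (c : C) : C := kap (g * rep c)%g.

Lemma coset_actE g h : coset_act g (kap h) = kap (g * h)%g.
Proof.
apply/eqP; rewrite /coset_act kapE invgM -!mulgA mulKg -kapE.
by rewrite kap_rep.
Qed.

Lemma coset_actP : is_act coset_act.
Proof.
split=> [c|g h c]; first by rewrite -[c in LHS]kap_rep coset_actE mul1g kap_rep.
by rewrite -(kap_rep c) !coset_actE mulgA.
Qed.

Lemma coset_act_U u c : u \in U -> coset_act u c = c.
Proof.
move=> uU; rewrite -(kap_rep c) coset_actE; apply/eqP; rewrite eq_sym kapE.
by rewrite -[(_ * _)%g]/(u ^ rep c)%g nU.
Qed.

Lemma coset_act_trans c c' : exists g, coset_act g c = c'.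
Proof.
exists (rep c' * (rep c)^-1)%g.
by have := coset_actE (rep c' * (rep c)^-1)%g (rep c); rewrite mulgVK !kap_rep.
Qed.

Lemma rep_coset_act g c : exists2 u, u \in U & (g * rep c)%g = (rep (coset_act g c) * u)%g.
Proof.
exists ((rep (coset_act g c))^-1 * (g * rep c))%g; last by rewrite mulVKg.
by rewrite -kapE kap_rep.
Qed.

(** Schreier generators. The representative [r1] of the trivial coset is added because it need not
    be 1: words based at that coset give elements of [U] conjugated by [r1]. *)
Lemma subgroup_finitely_generated : finitely_generated G -> finitely_generated (subgroup U).
Proof.
move=> /monoid_generators [d [x genx]].
have schreier g c : ((rep (coset_act g c))^-1 * (g * rep c))%g \in U.
  by rewrite -kapE kap_rep.
pose gam g c : subgroup U := exist (fun y => y \in U) _ (schreier g c).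
pose c1 := kap 1%g.
have r1U : rep c1 \in U by rewrite -[rep c1]mul1g -invg1 -kapE kap_rep.
pose r1 : subgroup U := exist (fun y => y \in U) _ r1U.
pose T : seq (subgroup U) := r1 :: [seq gam (x i) c | i <- enum 'I_d, c <- enum C].
exists T => u.
have genT w c : gam (wprod x w) c \in gen [in T].
  elim: w => [|i w IHw] /=.
    have -> : gam 1%g c = 1%g.
      by apply: val_inj; rewrite /= mul1g coset_actP.1 mulVg.
    exact: gpred1.
  have -> : gam (x i * wprod x w)%g c = (gam (x i) (coset_act (wprod x w) c) * gam (wprod x w) c)%g.
    apply: val_inj; rewrite /= coset_actP.2.
    by rewrite -!mulgA mulVKg.
  rewrite gpredM //; apply: Defs.mem_gen; rewrite inE; apply/orP; right.
  by apply/allpairsP; exists (i, coset_act (wprod x w) c); rewrite !mem_enum.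
have [w wu] := genx (val u).
have r1T : r1 \in gen [in T] by apply: Defs.mem_gen; rewrite !inE eqxx.
have -> : u = (r1 * gam (wprod x w) c1 * r1^-1)%g.
  apply: val_inj; rewrite /= wu coset_act_U ?(valP u) //.
  by rewrite mulVKg mulgK.
by rewrite gpredM ?gpredM ?gpredV.
Qed.

Lemma power_in_U g : exists2 n, (0 < n)%N & (g ^+ n)%g \in U.
Proof.
have /injectivePn [i [j ne eij]] : ~~ injectiveb (fun i : 'I_(#|C|.+1) => kap (g ^+ i)%g).
  apply/negP => /injectiveP /leq_card; rewrite card_ord ltnn //.
wlog ltij : i j ne eij / (i < j)%N.
  move=> h; case: (ltngtP i j) => [|ji|/val_inj e].
  - exact: h.
  - by apply: (h j i) => //; rewrite eq_sym.
  - by rewrite e eqxx in ne.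
exists (j - i)%N; first by rewrite subn_gt0.
move/eqP: eij; rewrite kapE; suff -> : (g ^+ (j - i) = g ^- i * g ^+ j)%g by [].
by rewrite -[in RHS](subnKC (ltnW ltij)) expgnDr mulKg.
Qed.

(* If the cocycle vanished on [U], summing [dl (g * rep c)] over [c] would give
   [#|C| * dl g = 0]. As [U] acts trivially on [C], the values of [dl] on [U] are
   homomorphisms, which [G] permutes by conjugation as it permutes [C]. *)
Lemma noninvariant_hom : limit_group G -> ~ abelian_group G -> (1 < #|C|)%N ->
  exists phi : G -> rat, {in U &, forall u v, phi (u * v)%g = phi u + phi v} /\
    exists2 u, u \in U & exists g, phi (u ^ g)%g <> phi u.
Proof.
move=> limG nabG C1.
have [dl [cdl sum0 sumr [g0 [c0 nz]]]] := limit_group_cocycle rep limG nabG coset_actP C1.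
have actVU u c : u \in U -> coset_act u^-1%g c = c.
  by move=> uU; apply: coset_act_U; rewrite gpredV.
have C0 : (#|C|%:R : rat) != 0 by rewrite pnatr_eq0 -lt0n ltnW.
have [u uU [c uc]] : exists2 u, u \in U & exists c, dl u c <> 0.
  apply: contrapT => no; apply: nz.
  have dlU u c : u \in U -> dl u c = 0.
    by move=> uU; apply: contrapT => ne; apply: no; exists u => //; exists c.
  have e c : dl (g0 * rep c)%g c0 = dl (rep (coset_act g0 c)) c0.
    by have [u uU ->] := rep_coset_act g0 c; rewrite cdl (dlU u) // addr0.
  have : \sum_c dl (g0 * rep c)%g c0 = 0.
    rewrite -[RHS](sumr c0) [RHS](reindex (coset_act g0)).
      by apply: eq_bigr => c _; rewrite e.
    by exists (coset_act g0^-1%g) => c _; rewrite ?(actK coset_actP) ?(actVK coset_actP).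
  under eq_bigr do rewrite cdl.
  rewrite big_split /= sumr addr0 sumr_const -mulr_natr => /eqP.
  by rewrite mulf_eq0 (negPf C0) orbF => /eqP.
(* A nonzero function with sum zero is not constant. *)
have [c' ne] : exists c', dl u c' <> dl u c.
  apply: contrapT => no; apply: uc.
  have := sum0 u; rewrite (eq_bigr (fun=> dl u c)); last first.
    by move=> c' _; apply: contrapT => ne; apply: no; exists c'.
  by rewrite sumr_const -mulr_natr => /eqP; rewrite mulf_eq0 (negPf C0) orbF => /eqP.
exists (fun v => dl v c); split=> [v w vU wU|].
  by rewrite cdl actVU.
exists u => //; have [g gc] := coset_act_trans c c'; exists g.
(* Two expansions of [dl] at g u^g = u g; the terms [dl g c'] cancel because [u] acts trivially. *)
have : dl g c' + dl (u ^ g)%g (coset_act g^-1%g c') = dl u c' + dl g (coset_act u^-1%g c').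
  by rewrite -!cdl -conjgC.
rewrite (actVU u) // [RHS]addrC -{2}gc (actK coset_actP) => /eqP.
by rewrite (inj_eq (addrI _)) => /eqP ->.
Qed.

(** In a relation between [phi] and the restrictions of the [psi i], comparing [u0] with a conjugate
    isolates the coefficient of [phi]. The remaining relation holds on [U], hence at a positive
    power of each element of [G], hence on [G], as [rat] is torsion-free. *)
Lemma rkQ_lt : limit_group G -> ~ abelian_group G -> (1 < #|C|)%N ->
  (rkQ G < rkQ (subgroup U))%N.
Proof.
move=> limG nabG C1.
have [phi [phiM [u0 u0U [g0 ne]]]] := noninvariant_hom limG nabG C1.
have [psi [psiM psi_ind]] := rkQ_hom_basis limG.1.
have := @rkQ_lower_bound (subgroup U) (option 'I_(rkQ G))
  (fun o u => if o is Some i then psi i (val u) else phi (val u))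
  (subgroup_finitely_generated limG.1).
rewrite card_option card_ord; apply=> [[i|] u v|c c0] /=.
- by rewrite psiM.
- exact: phiM (valP u) (valP v).
have cU u : u \in U -> c None * phi u + \sum_i c (Some i) * psi i u = 0.
  by move=> uU; have := c0 (exist (fun y => y \in U) u uU); rewrite sum_option.
have psi1 i : psi i 1%g = 0 by apply: (addrI (psi i 1%g)); rewrite -psiM mulg1 addr0.
have psiV i g : psi i g^-1%g = - psi i g.
  by apply: (addrI (psi i g)); rewrite -psiM mulgV psi1 subrr.
have psiJ i u g : psi i (u ^ g)%g = psi i u.
  by rewrite conjgE !psiM psiV addrCA addNr addr0.
have cN : c None = 0.
  have := cU _ (nU g0 u0U); under eq_bigr do rewrite psiJ.
  rewrite -[RHS](cU _ u0U) => /eqP; rewrite (inj_eq (addIr _)) -subr_eq0 -mulrBr mulf_eq0.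
  by rewrite [X in _ || X]subr_eq0 => /orP[/eqP|/eqP].
have psiX i g n : psi i (g ^+ n)%g = psi i g *+ n.
  by elim: n => [|n IHn]; rewrite ?expg0 ?psi1 // expgS psiM IHn mulrS.
have cS := psi_ind (fun i => c (Some i)).
case=> [i|//]; move: i; apply: cS => g.
have [n n0 gU] := power_in_U g.
have := cU _ gU; rewrite cN mul0r add0r.
under eq_bigr do rewrite psiX mulrnAr.
rewrite sumrMnl => /eqP; rewrite mulrn_eq0 eqn0Ngt n0 /= => /eqP //.
Qed.

End FiniteIndex.

Theorem theoremA (G : groupType) (p : nat) (U : groupClosed G)
    (limG : limit_group G) (nabG : ~ abelian_group G)
    (p_prime : prime p) (nUG : normal_subgroup U) (iUG : has_index U p) :
  rkQ G < rkQ (subgroup U).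
Proof.
have [kap kapE kap_surj] := has_index_cosets iUG.
apply: (rkQ_lt nUG kapE kap_surj limG nabG).
by rewrite card_ord prime_gt1.
Qed.
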